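(* Consider the equation $$Y_t = \xi_{t_0} + \int_{t_0}^t \mathbf 1_{\{ \varphi(s) < y \}} \big[ \alpha_1(s)\, dB_s + \beta_1(s)\, ds \big] + \int_{t_0}^t \mathbf 1_{\{ \varphi(s) \ge y \}} \big[ \alpha_2(s)\, dB_s + \beta_2(s)\, ds \big], \quad t \ge t_0, \qquad \varphi(t) = \mathbb P(Y_t \le \bar\mu_0),$$ with data $t_0, y, \alpha_1,\alpha_2,\beta_1,\beta_2,\xi_{t_0},\bar\mu_0$ as specified in the context. If there is a $\delta > 0$ such that $$-\tfrac12 \alpha_1(t)^2 \le \beta_1(t) \le -\tfrac14 \alpha_1(t)^2,$$ $$\tfrac14 \alpha_2(t)^2 \le \beta_2(t) \le \tfrac12 \alpha_2(t)^2$$ hold for all $t \in [t_0, t_0+\delta)$, and in both lines at least one of the inequalities is strict uniformly in $t$ (i.e. in each line, one and the same of the two inequalities is strict for every $t\in[t_0,t_0+\delta)$), then there is no $\varepsilon \in (0,\delta)$ such that the equation has a solution on the interval $[t_0, t_0+\varepsilon)$.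
   Context: $(\Omega, \mathcal F, \mathbb P, \mathbb F = (\mathcal F_t)_{t\in[0,\infty)})$ is a stochastic basis satisfying the usual conditions, and $B$ is a one-dimensional $\mathbb F$-Brownian motion. Data: (i) $t_0 \in [0,\infty)$ and $y \in (0,1)$; (ii) $\alpha_1,\alpha_2 : [0,\infty)\to[0,\infty)$ and $\beta_1,\beta_2 : [0,\infty)\to\mathbb R$ are continuous and bounded; (iii) $\xi_{t_0}$ is an $\mathcal F_{t_0}$-measurable random variable for which there exist parameters $(\bar\mu_0, \bar\mu_{t_0}, \bar\sigma_0^2, \bar\sigma_{t_0}^2) \in \mathbb R\times\mathbb R\times(0,\infty)\times[0,\infty)$ with $|\bar\mu_{t_0}| \le \frac12 \bar\sigma_{t_0}^2$, $\xi_{t_0} \sim \mathcal N(\bar\mu_0 + \bar\mu_{t_0}, \bar\sigma_0^2 + \bar\sigma_{t_0}^2)$ and $\mathbb P(\xi_{t_0} \le \bar\mu_0) = y$; the $\bar\mu_0$ in the equation is this parameter. A (strong) solution on $[t_0,T)$, $T\in(t_0,\infty]$, is an adapted process $(Y_t)_{t\in[t_0,T)}$ with continuous sample paths such that, with $\varphi(t) = \mathbb P(Y_t\le\bar\mu_0)$, the equation holds for all $t\in[t_0,T)$ $\mathbb P$-almost surely, and for all $S \in (t_0,T)$ the integral over $[t_0,S]$ of $\mathbf 1_{\{\varphi(s)<y\}}(\alpha_1(s)^2+|\beta_1(s)|) + \mathbf 1_{\{\varphi(s)\ge y\}}(\alpha_2(s)^2+|\beta_2(s)|)$ is finite. *)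

(* Defs.v *)
From HB Require Import structures.
From mathcomp Require Import all_boot all_order all_algebra.
From mathcomp Require Import all_classical all_reals all_analysis.
Set Implicit Arguments.
Unset Strict Implicit.
Unset Printing Implicit Defensive.
Import Order.TTheory GRing.Theory Num.Theory.
Import numFieldNormedType.Exports.
Local Open Scope classical_set_scope.
Local Open Scope ring_scope.

(* The time axis [0, oo) is the set of nonnegative elements
   of R; the values of a family indexed by R at negative times (or, for a
   process on [t0, T), at times outside [t0, T)) are irrelevant. *)

Section StochasticBasis.
Context {d : measure_display} {W : measurableType d} {R : realType}.
Implicit Types (P : probability W R) (F : R -> set (set W)).

Definition stochastic_basis P F : Prop :=
  [/\ forall t, 0 <= t -> sigma_algebra [set: W] (F t) /\ F t `<=` measurable,
      forall s t, 0 <= s -> s <= t -> F s `<=` F t,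
      forall t, 0 <= t -> F t = \bigcap_(s in [set s | t < s]) F s
    & P.-negligible `<=` F 0].

Definition measurable_wrt (G : set (set W)) (X : W -> R) : Prop :=
  forall C : set R, measurable C -> G (X @^-1` C).

(* N(m, v) is parametrized by its variance v.  It is only used with 0 < v:
   [normal_prob m 0] is not the Dirac mass at m. *)
Definition has_normal_law P (X : W -> R) (m v : R) : Prop :=
  measurable_fun [set: W] X /\
  forall C : set R, measurable C -> P (X @^-1` C) = normal_prob m (Num.sqrt v) C.

Definition independent_of P (X : W -> R) (G : set (set W)) : Prop :=
  forall (A : set W) (C : set R), G A -> measurable C ->
    P (A `&` X @^-1` C) = (P A * P (X @^-1` C))%E.

Definition brownian_motion P F (B : R -> W -> R) : Prop :=
  [/\ forall t, 0 <= t -> measurable_wrt (F t) (B t),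
      {ae P, forall w, B 0 w = 0},
      {ae P, forall w, {within `[0, +oo[, continuous (B ^~ w)}},
      forall s t, 0 <= s -> s < t ->
        independent_of P (fun w => B t w - B s w) (F s)
    & forall s t, 0 <= s -> s < t ->
        has_normal_law P (fun w => B t w - B s w) 0 (t - s)].

(* The data of a simple process
   H = \sum_(i < n) zeta_i 1_(t_i, t_(i+1)]. *)
Record simple_process := SimpleProcess {
  sp_size : nat;
  sp_time : nat -> R;
  sp_coef : nat -> W -> R }.

Definition simple_process_on F (a b : R) (H : simple_process) : Prop :=
  [/\ forall i, (i <= sp_size H)%N -> a <= sp_time H i <= b,
      forall i, (i < sp_size H)%N -> sp_time H i <= sp_time H i.+1,
      forall i, (i < sp_size H)%N ->
        measurable_wrt (F (sp_time H i)) (sp_coef H i)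
    & forall i, (i < sp_size H)%N ->
        exists M : R, forall w, `|sp_coef H i w| <= M].

Definition simple_value (H : simple_process) (u : R) (w : W) : R :=
  \sum_(i < sp_size H)
    sp_coef H i w * \1_(`]sp_time H i, sp_time H i.+1]) u.

Definition simple_integral (B : R -> W -> R) (H : simple_process) (w : W) : R :=
  \sum_(i < sp_size H)
    sp_coef H i w * (B (sp_time H i.+1) w - B (sp_time H i) w).

(* J is (a version of) the Ito integral of H dB over [a, b], for H jointly
   measurable, adapted and in L^2([a, b] x W): J is the L^2(P)-limit of the
   integrals of simple processes converging to H in L^2([a, b] x W).  The Ito
   isometry makes J unique up to a P-null set.  A deterministic integrand
   belongs to this class as soon as it is measurable and its square is
   integrable over [a, b], so no localization is needed for it. *)
Definition ito_integral P F (B : R -> W -> R) (H : R -> W -> R) (a b : R)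
    (J : W -> R) : Prop :=
  [/\ measurable_fun (`[a, b] `*` [set: W]) (fun p : R * W => H p.1 p.2),
      forall u, a <= u <= b -> measurable_wrt (F u) (H u),
      measurable_wrt (F b) J
    & exists Hn : nat -> simple_process,
      [/\ forall n, simple_process_on F a b (Hn n),
          (\int[P]_w \int[lebesgue_measure]_(u in `[a, b])
             ((simple_value (Hn n) u w - H u w) ^+ 2)%:E)%E @[n --> \oo]
             --> 0%E
        & (\int[P]_w ((simple_integral B (Hn n) w - J w) ^+ 2)%:E)%E
             @[n --> \oo] --> 0%E]].

Section Equation.
Context (P : probability W R) (F : R -> set (set W)) (B : R -> W -> R).
Context (t0 y : R) (alpha1 alpha2 beta1 beta2 : R -> R) (xi : W -> R) (mu0 : R).

Definition time_interval (T : \bar R) : set R :=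
  [set t | t0 <= t /\ (t%:E < T)%E].

Definition cdf_at_mu0 (Y : R -> W -> R) (t : R) : R :=
  fine (P [set w | Y t w <= mu0]).

Definition below (Y : R -> W -> R) (t : R) : R := (cdf_at_mu0 Y t < y)%R%:R.
Definition above (Y : R -> W -> R) (t : R) : R := (y <= cdf_at_mu0 Y t)%R%:R.

(* The two ds-integrals are meaningful (and not junk values) because of the
   integrability condition in [solution]. *)
Definition equation_at (Y : R -> W -> R) (t : R) : Prop :=
  exists J1 J2 : W -> R,
    [/\ ito_integral P F B (fun s _ => below Y s * alpha1 s) t0 t J1,
        ito_integral P F B (fun s _ => above Y s * alpha2 s) t0 t J2
      & {ae P, forall w, Y t w = xi w
          + (J1 w + \int[lebesgue_measure]_(s in `[t0, t]) (below Y s * beta1 s))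
          + (J2 w + \int[lebesgue_measure]_(s in `[t0, t]) (above Y s * beta2 s))}].

Definition solution (T : \bar R) (Y : R -> W -> R) : Prop :=
  [/\ forall t, time_interval T t -> measurable_wrt (F t) (Y t),
      forall w, {within time_interval T, continuous (Y ^~ w)},
      forall t, time_interval T t -> equation_at Y t
    & forall S : R, t0 < S -> (S%:E < T)%E ->
        (\int[lebesgue_measure]_(s in `[t0, S])
          (below Y s * (alpha1 s ^+ 2 + `|beta1 s|)
           + above Y s * (alpha2 s ^+ 2 + `|beta2 s|))%:E < +oo)%E].

End Equation.
End StochasticBasis.

(* Main.v *)
Require Import Defs.
From HB Require Import structures.
From mathcomp Require Import all_boot all_order all_algebra.
From mathcomp Require Import all_classical all_reals all_analysis.
From mathcomp Require Import measurable_realfun ring lra.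
Import Order.TTheory GRing.Theory Num.Theory.
Import numFieldNormedType.Exports.
Set Implicit Arguments.
Unset Strict Implicit.
Unset Printing Implicit Defensive.
Local Open Scope classical_set_scope.
Local Open Scope ring_scope.

(** The indicators in the equation depend on time only, so along a solution [Y]
    the coefficients are deterministic and [Y t] is Gaussian: with
      [M t = mu0 + mut0 + ] integral of the drift over [[t0, t]],
      [V t = var0 + vart0 + ] integral of the squared volatility over [[t0, t]],
    the distribution function satisfies [phi t = Phi ((mu0 - M t) / sqrt (V t))].
    Put [c := mut0 / sqrt (V t0)].  As [Phi] is strictly increasing,
    [phi t < y] means [c * sqrt (V t) < M t - mu0], and similarly for [=] and [>].
    The hypotheses on the initial law give [|c| < sqrt (V t0) / 2].

    Suppose [phi t < y], and let [s] be the last time before [t] at which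
    [phi s = y] ([last_exit]).  On [(s, t]] the first regime is active, whose
    drift is at most [- alpha1 ^ 2 / 4], so [M] falls by at least
    [(V t - V s) / 4].  Meanwhile [c * sqrt V] falls by at most
    [sqrt (V t0) / 2 * (sqrt (V t) - sqrt (V s)) <= (V t - V s) / 4], so [M - mu0]
    cannot end up above [c * sqrt V] ([no_upcrossing]).  The second regime
    excludes [y < phi t] in the same way ([no_downcrossing]).  Hence [phi] is
    constantly [y] and the second regime is active all the time.  But then
    [M - mu0 = c * sqrt V] throughout, and as [|c|] is strictly smaller than
    [sqrt (V t0) / 2] this forces [V] to be constant ([level_forces_equality]).
    So [alpha2 ^ 2] and [beta2] both have integral [0] over some [[t0, t]],
    although one of [beta2 - alpha2 ^ 2 / 4] and [alpha2 ^ 2 / 2 - beta2] is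
    positive there: a contradiction.  No derivative of [M] or [V] is taken, which
    is why the bounded, merely measurable switching indicators do no harm.

    Two points need work.

    The law of [Y t] ([solution_cdf]).  The stochastic integral is a limit in L2 of
    integrals of simple processes with random coefficients.  Replacing the
    coefficients by their expectations is an orthogonal projection: it brings
    the simple process closer to its deterministic target, and by the isometry
    for simple processes it changes the integral by a quantity that tends to [0]
    ([simple_to_step]).  So the integral is a limit of integrals of
    deterministic step functions, i.e. of linear combinations of increments of
    [B].  Such a combination, added to the initial value, is Gaussian because
    adding an independent increment adds variances.  That fact needs no
    convolution of densities: it holds for the increments of [B] themselves, and
    the law of an independent sum depends only on the laws of its terms
    ([independent_sum_law], [normal_add_increment]).  Finally distribution
    functions pass to the limit because [Phi] is continuous
    ([wiener_limit_cdf]).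

    The continuity of [phi] ([phi_seq_continuous]).  The paths of [Y] are continuous
    and the law of [Y s] has no atom, so dominated convergence applies to the
    indicators of [Y <= mu0].  The continuity makes the switching indicators
    measurable and last exit times available. *)

(** * Normal laws and the standard normal distribution function *)

Section NormalLaw.
Context {R : realType}.
Implicit Types (m s k c x : R) (A : set R).

(** Uniqueness of the Lebesgue measure: the scaled image measure agrees with it
    on half-open intervals. *)
Lemma lebesgue_measure_affine k c A : k != 0 -> measurable A ->
  lebesgue_measure ((fun x => k * x + c) @^-1` A) =
  ((`|k|^-1)%:E * lebesgue_measure A)%E.
Proof.
move=> k0 mA.
pose phi (x : measurableTypeR R) : measurableTypeR R := k * x + c.
have mphi : measurable_fun [set: measurableTypeR R] phi.
  by apply: measurable_funD => //; apply: measurable_funM.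
have K0 : 0 <= `|k| by [].
pose nu : {measure set (measurableTypeR R) -> \bar R} :=
  mscale (NngNum K0)
    (measure_function_pushforward__canonical__measure_function_Measure
       lebesgue_measure mphi).
suff H : forall X, ocitv X -> lebesgue_measure X = nu X.
  rewrite (lebesgue_measure_unique H mA) /nu /mscale /= muleA -EFinM.
  by rewrite mulVf ?normr_eq0// mul1e.
move=> X /ocitvP[->|[[a b] /= ab ->]]; first by rewrite measure0 measure0.
rewrite /nu /mscale /= /pushforward /phi lebesgue_measure_itv /= lte_fin ab.
have [k_gt0|k_lt0|/eqP] := ltgtP k 0; last by rewrite (negbTE k0).
- rewrite [X in lebesgue_measure X](_ : _ = `[(b - c) / k, (a - c) / k[%classic).
    rewrite lebesgue_measure_itv /= lte_fin ltr_nM2r ?invr_lt0// ltrD2r ab.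
    rewrite -!EFinB -EFinM (ltr0_norm k_gt0); congr EFin.
    by field.
  apply/seteqP; split => x /=; rewrite !in_itv /= => /andP[h1 h2]; apply/andP; split.
  + by rewrite ler_ndivrMr// mulrC; lra.
  + by rewrite ltr_ndivlMr// mulrC; lra.
  + by move: h2; rewrite ltr_ndivlMr// mulrC; lra.
  + by move: h1; rewrite ler_ndivrMr// mulrC; lra.
- rewrite [X in lebesgue_measure X](_ : _ = `](a - c) / k, (b - c) / k]%classic).
    rewrite lebesgue_measure_itv /= lte_fin ltr_pM2r ?invr_gt0// ltrD2r ab.
    rewrite -!EFinB -EFinM (gtr0_norm k_lt0); congr EFin.
    by field.
  apply/seteqP; split => x /=; rewrite !in_itv /= => /andP[h1 h2]; apply/andP; split.
  + by rewrite ltr_pdivrMr// mulrC; lra.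
  + by rewrite ler_pdivlMr// mulrC; lra.
  + by move: h1; rewrite ltr_pdivrMr// mulrC; lra.
  + by move: h2; rewrite ler_pdivlMr// mulrC; lra.
Qed.

(** Both signs of [k] are covered, so that symmetry ([k = -1]) and scaling are
    instances. *)
Lemma normal_prob_affine m s k c A : s != 0 -> k != 0 -> measurable A ->
  normal_prob m s ((fun x => k * x + c) @^-1` A) =
  normal_prob (k * m + c) (`|k| * s) A.
Proof.
move=> s0 k0 mA.
pose phi (x : measurableTypeR R) : measurableTypeR R := k * x + c.
have mphi : measurable_fun [set: measurableTypeR R] phi.
  by apply: measurable_funD => //; apply: measurable_funM.
have K0 : 0 <= `|k|^-1 by rewrite invr_ge0.
have ks0 : `|k| * s != 0 by rewrite mulf_neq0// normr_eq0.
have pdfE x : normal_pdf m s x = `|k| * normal_pdf (k * m + c) (`|k| * s) (k * x + c).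
  rewrite !normal_pdfE// mulrA /normal_peak /normal_fun; congr (_ * _).
    rewrite exprMn real_normK ?num_real//.
    rewrite [X in _ = _ / Num.sqrt X](_ : _ = k ^+ 2 * (s ^+ 2 * pi *+ 2)); last by ring.
    rewrite sqrtrM ?sqr_ge0// sqrtr_sqr invfM mulrA.
    by rewrite divff ?normr_eq0// mul1r.
  congr expR; rewrite exprMn real_normK ?num_real//.
  by field; rewrite s0 k0.
rewrite /normal_prob.
transitivity (\int[pushforward lebesgue_measure phi]_(y in A)
   (`|k| * normal_pdf (k * m + c) (`|k| * s) y)%:E)%E.
  rewrite ge0_integral_pushforward//.
  - by apply: eq_integral => x _; rewrite pdfE.
  - apply/measurable_EFinP; apply: measurable_funTS.
    by apply: measurable_funM => //; exact: measurable_normal_pdf.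
  - by move=> y _; rewrite lee_fin mulr_ge0// normal_pdf_ge0.
transitivity (\int[mscale (NngNum K0) lebesgue_measure]_(y in A)
   (`|k| * normal_pdf (k * m + c) (`|k| * s) y)%:E)%E.
  apply: eq_measure_integral => X mX XA.
  by rewrite /mscale /= /pushforward lebesgue_measure_affine.
have mpdf : measurable_fun A (fun y => (normal_pdf (k * m + c) (`|k| * s) y)%:E).
  by apply/measurable_EFinP; apply: measurable_funTS; exact: measurable_normal_pdf.
rewrite ge0_integral_mscale//; last 2 first.
- apply/measurable_EFinP; apply: measurable_funTS.
  by apply: measurable_funM => //; exact: measurable_normal_pdf.
- by move=> y _; rewrite lee_fin mulr_ge0// normal_pdf_ge0.
under eq_integral do rewrite EFinM.
rewrite ge0_integralZl//; last by move=> x _; rewrite lee_fin normal_pdf_ge0.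
by rewrite muleA -EFinM /= mulVf ?normr_eq0// mul1e.
Qed.

Definition Phi x : R := fine (normal_prob 0 1 `]-oo, x]).

Lemma normal_prob_fin_num m s A : measurable A -> normal_prob m s A \is a fin_num.
Proof. by move=> mA; apply: fin_num_measure. Qed.

Lemma normal_prob_itvNy m s x : 0 < s ->
  normal_prob m s `]-oo, x] = (Phi ((x - m) / s))%:E.
Proof.
move=> s0; rewrite /Phi fineK; last exact: normal_prob_fin_num.
have s1 : s != 0 by rewrite gt_eqF.
rewrite -[in LHS](add0r m) -{1}(mulr0 s) -{2}(mulr1 s) -{2}(gtr0_norm s0).
rewrite -normal_prob_affine ?oner_eq0//; congr normal_prob.
apply/seteqP; split => z /=; rewrite !in_itv /= => h.
  by rewrite ler_pdivlMr// mulrC; lra.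
by move: h; rewrite ler_pdivlMr// mulrC; lra.
Qed.

Let Phi_diff x y : x <= y -> normal_prob 0 1 `]x, y] = (Phi y - Phi x)%:E.
Proof.
move=> xy.
have fA (A : set R) : measurable A -> normal_prob 0 1 A \is a fin_num.
  exact: normal_prob_fin_num.
have H : normal_prob 0 1 `]-oo, y] =
    (normal_prob 0 1 `]-oo, x] + normal_prob 0 1 `]x, y])%E.
  rewrite -measureU//; first by rewrite -itv_bndbnd_setU.
  apply/seteqP; split => z //=; rewrite !in_itv /= => -[zx /andP[xz _]].
  by move: xz; rewrite ltNge zx.
rewrite /Phi H fineD ?fA// addrAC subrr add0r fineK// fA//.
Qed.

(** The density is bounded by its peak. *)
Lemma Phi_lipschitz x y : x <= y -> Phi y - Phi x <= normal_peak 1 * (y - x).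
Proof.
move=> xy; rewrite -lee_fin -Phi_diff//.
apply: (@le_trans _ _ (\int[lebesgue_measure]_(z in `]x, y]) (normal_peak 1)%:E)%E).
  apply: ge0_le_integral => //.
  - by move=> z _; rewrite lee_fin normal_pdf_ge0.
  - by apply/measurable_EFinP; apply: measurable_funTS; exact: measurable_normal_pdf.
  - by move=> z _; rewrite lee_fin normal_pdf_ub.
rewrite integral_cst//= lebesgue_measure_itv /= lte_fin.
by case: ltP => h; rewrite -?EFinB -?EFinM lee_fin// ?mulr0 mulr_ge0 ?normal_peak_ge0// subr_ge0.
Qed.

(** On [[x, y]] the density is bounded below by a positive constant. *)
Lemma Phi_increasing x y : x < y -> Phi x < Phi y.
Proof.
move=> xy; rewrite -subr_gt0 -lte_fin -Phi_diff ?(ltW xy)//.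
pose e : R := normal_peak 1 * expR (- ((x ^+ 2 + y ^+ 2) / 2)).
have e0 : 0 < e by rewrite mulr_gt0 ?expR_gt0// normal_peak_gt0.
apply: (@lt_le_trans _ _ (\int[lebesgue_measure]_(z in `]x, y]) e%:E)%E).
  rewrite integral_cst//= lebesgue_measure_itv /= lte_fin xy.
  by rewrite -EFinB -EFinM lte_fin mulr_gt0// subr_gt0.
apply: ge0_le_integral => //.
- by move=> z _; rewrite lee_fin ltW.
- by apply/measurable_EFinP; apply: measurable_funTS; exact: measurable_normal_pdf.
- move=> z /=; rewrite in_itv /= => /andP[xz zy].
  rewrite lee_fin normal_pdfE// /e ler_wpM2l ?normal_peak_ge0// ler_expR subr0.
  rewrite expr1n mulNr lerN2 ler_pM2r ?invr_gt0//.
  have [?|?] := leP 0 z; nra.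
Qed.

Lemma Phi_inj : injective Phi.
Proof.
move=> x y; have [/Phi_increasing h|/Phi_increasing h|//] := ltgtP x y.
  by move=> e; rewrite e ltxx in h.
by move=> e; rewrite e ltxx in h.
Qed.

End NormalLaw.
(** * Second moments of centred normal laws *)

Section NormalMoments.
Context {R : realType}.
Implicit Types (m s a b : R).

(** The density and the Radon-Nikodym derivative have the same integral over every
    measurable set, hence agree almost everywhere. *)
Lemma ge0_integral_normal_prob m s (f : R -> \bar R) :
  measurable_fun [set: R] f -> (forall x, 0 <= f x)%E ->
  (\int[normal_prob m s]_x f x =
   \int[lebesgue_measure]_x (f x * (normal_pdf m s x)%:E))%E.
Proof.
move=> mf f0.
have dom := normal_prob_dominates m s.
pose g := Radon_Nikodym_SigmaFinite.f (normal_prob m s) lebesgue_measure.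
have intg : lebesgue_measure.-integrable [set: R] g.
  exact: Radon_Nikodym_SigmaFinite.f_integrable.
rewrite -(Radon_Nikodym_SigmaFinite.change_of_variables dom)//.
apply: ae_eq_integral => //.
- by apply: emeasurable_funM => //; exact: measurable_int intg.
- by apply: emeasurable_funM => //; apply/measurable_EFinP; exact: measurable_normal_pdf.
- apply: ae_eqe_mul2l; apply: integral_ae_eq => //.
    by apply/measurable_EFinP; exact: measurable_normal_pdf.
  by move=> E _ mE; rewrite -(Radon_Nikodym_SigmaFinite.f_integral dom).
Qed.

(** From [z <= expR z] at [z = x ^+ 2 / 4], [x ^+ 2] times the density of N(0, 1) is
    dominated by a multiple of the density of N(0, 2). *)
Lemma normal_moment2_lty : (\int[normal_prob 0 1]_x (x ^+ 2 : R)%:E < +oo)%E.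
Proof.
rewrite ge0_integral_normal_prob; last 2 first.
- by apply/measurable_EFinP; exact: measurable_funX.
- by move=> x; rewrite lee_fin sqr_ge0.
have s0 : Num.sqrt 2 != 0 :> R by rewrite gt_eqF// sqrtr_gt0.
pose C : R := 4 * normal_peak 1 / normal_peak (Num.sqrt 2).
have C0 : 0 <= C by rewrite !mulr_ge0 ?invr_ge0 ?normal_peak_ge0.
apply: (@le_lt_trans _ _
    (\int[lebesgue_measure]_x (C%:E * (normal_pdf 0 (Num.sqrt 2) x)%:E))%E).
  apply: ge0_le_integral => //.
  - by move=> x _; rewrite -EFinM lee_fin mulr_ge0 ?sqr_ge0 ?normal_pdf_ge0.
  - apply/measurable_EFinP; apply: measurable_funM; first exact: measurable_funX.
    exact: measurable_normal_pdf.
  - by apply/measurable_EFinP; apply: measurable_funM => //; exact: measurable_normal_pdf.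
  - move=> x _; rewrite -!EFinM lee_fin !normal_pdfE ?oner_eq0//.
    rewrite [X in _ <= X](_ : _ =
        normal_peak 1 * (4 * normal_fun 0 (Num.sqrt 2) x)); last first.
      by rewrite /C mulrA divfK ?gt_eqF ?normal_peak_gt0// -mulrA mulrCA.
    rewrite mulrCA ler_wpM2l ?normal_peak_ge0//.
    rewrite /normal_fun !subr0 expr1n sqr_sqrtr//.
    have -> : - x ^+ 2 / (1 *+ 2) = - x ^+ 2 / (2 *+ 2) + (- (x ^+ 2 / 4)) by field.
    rewrite expRD mulrCA [X in _ <= X]mulrC ler_wpM2l ?expR_ge0//.
    rewrite expRN ler_pdivrMr ?expR_gt0//.
    have := expR_ge1Dx (x ^+ 2 / 4); lra.
rewrite ge0_integralZl//=.
- by rewrite integral_normal_pdf mule1 ltry.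
- by apply/measurable_EFinP; exact: measurable_normal_pdf.
- by move=> x _; rewrite lee_fin normal_pdf_ge0.
Qed.

(** The second moment of N(0, 1), left unevaluated: it is the constant of the
    isometry below, which requires no more than its finiteness. *)
Definition normal_moment2 : R := fine (\int[normal_prob 0 1]_x (x ^+ 2 : R)%:E).

Lemma normal_moment2_ge0 : 0 <= normal_moment2.
Proof. by apply: fine_ge0; apply: integral_ge0 => x _; rewrite lee_fin sqr_ge0. Qed.

Lemma ge0_integral_normal_scale s k (f : R -> \bar R) : s != 0 -> k != 0 ->
  measurable_fun [set: R] f -> (forall x, 0 <= f x)%E ->
  (\int[normal_prob 0 (`|k| * s)]_x f x = \int[normal_prob 0 s]_x f (k * x)%R)%E.
Proof.
move=> s0 k0 mf f0.
have mk : measurable_fun [set: measurableTypeR R]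
  (fun x : measurableTypeR R => k * x : measurableTypeR R) by exact: measurable_funM.
transitivity (\int[pushforward (normal_prob 0 s)
  (fun x : measurableTypeR R => (k * x)%R : measurableTypeR R)]_x f x)%E.
  apply: eq_measure_integral => A mA _.
  have := @normal_prob_affine R 0 s k 0 A s0 k0 mA.
  rewrite mulr0 addr0 => e; apply: etrans (esym e) _.
  rewrite /pushforward /=; congr normal_prob.
  by apply/seteqP; split => x /=; rewrite addr0.
by rewrite ge0_integral_pushforward.
Qed.

Lemma normal_square s : 0 < s ->
  (\int[normal_prob 0 s]_x (x ^+ 2 : R)%:E = (s ^+ 2 * normal_moment2)%:E)%E.
Proof.
move=> s0; rewrite -{1}(mulr1 s) -{1}(gtr0_norm s0).
rewrite (@ge0_integral_normal_scale 1 s (fun x => (x ^+ 2)%:E)) ?oner_eq0 ?gt_eqF//; last 2 first.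
- by apply/measurable_EFinP; exact: measurable_funX.
- by move=> x; rewrite lee_fin sqr_ge0.
under eq_integral do rewrite exprMn EFinM.
rewrite ge0_integralZl ?lee_fin ?sqr_ge0//=.
- rewrite [RHS]EFinM; congr (_ * _)%E.
  rewrite fineK// ge0_fin_numE ?normal_moment2_lty//.
  by apply: integral_ge0 => x _; rewrite lee_fin sqr_ge0.
- by apply/measurable_EFinP; exact: measurable_funX.
- by move=> x _; rewrite lee_fin sqr_ge0.
Qed.

(** Replacing [b] by [- b] does not change the integral, by symmetry of the law;
    averaging both integrals cancels the cross term. *)
Lemma normal_affine_square s a b : 0 < s ->
  (\int[normal_prob 0 s]_x ((a + b * x) ^+ 2 : R)%:E =
   (a ^+ 2 + b ^+ 2 * (s ^+ 2 * normal_moment2))%:E)%E.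
Proof.
move=> s0.
have mq (c e : R) : measurable_fun [set: R] (fun x => ((c + e * x) ^+ 2)%:E).
  apply/measurable_EFinP; apply: measurable_funX.
  by apply: measurable_funD => //; exact: measurable_funM.
have q0 (c e x : R) : (0 <= ((c + e * x) ^+ 2)%:E)%E by rewrite lee_fin sqr_ge0.
have sym : (\int[normal_prob 0 s]_x ((a + b * x) ^+ 2)%:E =
            \int[normal_prob 0 s]_x ((a + - b * x) ^+ 2)%:E)%E.
  have N1 : -1 != 0 :> R by rewrite oppr_eq0 oner_eq0.
  rewrite -{1}(mul1r s) -(normr1 R) -normrN.
  rewrite (@ge0_integral_normal_scale s (-1) (fun x => ((a + b * x) ^+ 2)%:E))//; last first.
    by rewrite gt_eqF.
  by apply: eq_integral => x _; rewrite mulN1r mulrN mulNr.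
have sum : (\int[normal_prob 0 s]_x ((a + b * x) ^+ 2)%:E +
            \int[normal_prob 0 s]_x ((a + - b * x) ^+ 2)%:E =
   (2 * (a ^+ 2 + b ^+ 2 * (s ^+ 2 * normal_moment2)))%:E)%E.
  rewrite -ge0_integralD//; [|exact: mq|exact: mq].
  under eq_integral => x _.
    rewrite -EFinD (_ : _ + _ = 2 * a ^+ 2 + 2 * b ^+ 2 * x ^+ 2); last by ring.
    rewrite EFinD EFinM (EFinM _ (x ^+ 2)) -[(_ * _)%E]EFinM; over.
  rewrite ge0_integralD//; last 3 first.
  - by move=> x _; rewrite lee_fin mulr_ge0// sqr_ge0.
  - by move=> x _; rewrite -EFinM lee_fin mulr_ge0 ?sqr_ge0// mulr_ge0 ?sqr_ge0.
  - by apply/measurable_EFinP; apply: measurable_funM => //; exact: measurable_funX.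
  rewrite integral_cst//= ge0_integralZl//; last 3 first.
  - by apply/measurable_EFinP; exact: measurable_funX.
  - by move=> x _; rewrite lee_fin sqr_ge0.
  - by rewrite lee_fin mulr_ge0// sqr_ge0.
  rewrite normal_square// probability_setT mule1 -EFinM -EFinD; congr EFin; ring.
move: sum; rewrite -sym; case: (integral _ _ _) => //= r.
by rewrite -EFinD => -[rr]; congr EFin; lra.
Qed.

End NormalMoments.
(** * Independent increments of the Brownian motion *)

Section Freezing.
Context {d : measure_display} {W : measurableType d} {R : realType}.
Variables (P : probability W R) (G : set (set W)).
Hypotheses (sG : sigma_algebra [set: W] G) (GM : G `<=` measurable).

(** Transfers the closure of measurable functions under sums and products to
    [measurable_wrt]. *)
Lemma measurable_wrtP (X : W -> R) : measurable_wrt G X <->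
  measurable_fun [set: g_sigma_algebraType G] (X : g_sigma_algebraType G -> R).
Proof.
split=> [mX _ C mC|mX C mC].
  by rewrite setTI; apply: sub_sigma_algebra; exact: mX.
by have := mX measurableT C mC; rewrite setTI measurable_g_measurableTypeE.
Qed.

Lemma measurable_wrt_fun (X : W -> R) : measurable_wrt G X -> measurable_fun [set: W] X.
Proof. by move=> mX _ C mC; rewrite setTI; apply: GM; exact: mX. Qed.

(** Freezing: given [G], the [G]-measurable argument of [f] may be treated as a
    constant.  The law of [w |-> (w, Z w)] on [G] times the real line is a product
    measure, so this is Tonelli's theorem. *)
Lemma ge0_integral_independent (Z : W -> R)
    (f : g_sigma_algebraType G * R -> \bar R) :
  measurable_fun [set: W] Z -> independent_of P Z G ->
  measurable_fun [set: g_sigma_algebraType G * R] f ->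
  (forall x, 0 <= f x)%E ->
  (\int[P]_w f (w, Z w) = \int[P]_w \int[P]_w' f (w, Z w'))%E.
Proof.
move=> mZ indZ mf f0.
have mid : measurable_fun [set: W] (id : W -> g_sigma_algebraType G).
  move=> _ A; rewrite measurable_g_measurableTypeE// => GA.
  by rewrite setTI; exact: GM.
have mid_ : (id : W -> g_sigma_algebraType G) \in mfun by rewrite inE.
pose idG : {mfun W >-> g_sigma_algebraType G} := mfun_Sub mid_.
pose PG : probability (g_sigma_algebraType G) R := distribution P idG.
have mZ_ : (Z : W -> R) \in mfun by rewrite inE.
pose Zm : {mfun W >-> R} := mfun_Sub mZ_.
pose nu : probability R R := distribution P Zm.
have mpair : measurable_fun [set: W] (fun w => (w, Z w) : g_sigma_algebraType G * R).
  exact: measurable_fun_pair.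
have mpair_ : (fun w => (w, Z w) : g_sigma_algebraType G * R) \in mfun by rewrite inE.
pose pairG : {mfun W >-> (g_sigma_algebraType G * R)%type} := mfun_Sub mpair_.
pose m' : probability (g_sigma_algebraType G * R)%type R := distribution P pairG.
have prodE : forall X, measurable X -> (PG \x nu)%E X = m' X.
  apply: product_measure_unique => A C mA mC.
  have GA : G A by rewrite -(measurable_g_measurableTypeE sG).
  apply: (@etrans _ _ (P (A `&` Z @^-1` C))); first by [].
  by rewrite indZ.
transitivity (\int[m']_x f x)%E.
  by rewrite ge0_integral_distribution.
transitivity (\int[(PG \x nu)%E]_x f x)%E.
  by apply: eq_measure_integral => A mA _; apply/esym; exact: prodE.
rewrite fubini_tonelli1// ge0_integral_distribution//.
- apply: eq_integral => w _; rewrite /fubini_F /= ge0_integral_distribution//.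
  exact: measurableT_comp.
- exact: measurable_fun_fubini_tonelli_F.
- by move=> y; apply: integral_ge0 => z _.
Qed.

End Freezing.

Section SumLaw.
Context {d : measure_display} {W : measurableType d} {R : realType}.
Variables (P : probability W R).

Lemma eq_integral_law (X X' : W -> R) (h : R -> \bar R) :
  measurable_fun [set: W] X -> measurable_fun [set: W] X' ->
  (forall C, measurable C -> P (X @^-1` C) = P (X' @^-1` C)) ->
  measurable_fun [set: R] h -> (forall x, 0 <= h x)%E ->
  (\int[P]_w h (X w) = \int[P]_w h (X' w))%E.
Proof.
move=> mX mX' eqX mh h0.
transitivity (\int[pushforward P X]_x h x)%E; first by rewrite ge0_integral_pushforward.
transitivity (\int[pushforward P X']_x h x)%E; last by rewrite ge0_integral_pushforward.
by apply: eq_measure_integral => A mA _; exact: eqX.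
Qed.

(** By freezing, the law of an independent sum is computed from the laws of its
    two terms alone. *)
Lemma independent_sum_law (G G' : set (set W)) (X X' Z Z' : W -> R) :
  sigma_algebra [set: W] G -> G `<=` measurable ->
  sigma_algebra [set: W] G' -> G' `<=` measurable ->
  measurable_wrt G X -> measurable_wrt G' X' ->
  (forall C, measurable C -> P (X @^-1` C) = P (X' @^-1` C)) ->
  measurable_fun [set: W] Z -> measurable_fun [set: W] Z' ->
  (forall C, measurable C -> P (Z @^-1` C) = P (Z' @^-1` C)) ->
  independent_of P Z G -> independent_of P Z' G' ->
  forall C, measurable C ->
  P ((fun w => X w + Z w) @^-1` C) = P ((fun w => X' w + Z' w) @^-1` C).
Proof.
move=> sG GM sG' GM' mX mX' eqX mZ mZ' eqZ indZ indZ' C mC.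
pose g (p : R * R) : \bar R := (\1_C (p.1 + p.2))%:E.
have mg : measurable_fun [set: R * R] g.
  apply/measurable_EFinP; apply: measurableT_comp; first exact: measurable_indic.
  exact: measurable_funD.
have g0 p : (0 <= g p)%E by rewrite lee_fin.
pose h (x : R) := (\int[P]_w g (x, Z w))%E.
have gE x : measurable_fun [set: R] (fun z => g (x, z)) by exact: measurableT_comp.
have key (H : set (set W)) (X1 Z1 : W -> R) : sigma_algebra [set: W] H ->
    H `<=` measurable -> measurable_wrt H X1 -> measurable_fun [set: W] Z1 ->
    (forall C, measurable C -> P (Z1 @^-1` C) = P (Z @^-1` C)) ->
    independent_of P Z1 H ->
    P ((fun w => X1 w + Z1 w) @^-1` C) = (\int[P]_w h (X1 w))%E.
  move=> sH HM mX1 mZ1 law1 ind1.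
  have mX1' := measurable_wrt_fun HM mX1.
  have mS : measurable ((fun w => X1 w + Z1 w) @^-1` C).
    by rewrite -[X in measurable X]setTI; exact: (measurable_funD mX1' mZ1).
  transitivity (\int[P]_w g (X1 w, Z1 w))%E.
    transitivity (\int[P]_w (\1_((fun w => X1 w + Z1 w) @^-1` C) w)%:E)%E => //.
    by rewrite integral_indic// setIT.
  pose f (p : g_sigma_algebraType H * R) := g (X1 p.1, p.2).
  have mf : measurable_fun [set: g_sigma_algebraType H * R] f.
    apply: (measurableT_comp mg); apply: measurable_fun_pair => /=.
      by apply: measurableT_comp; [exact/(measurable_wrtP sH)|exact: measurable_fst].
    exact: measurable_snd.
  have f0 p : (0 <= f p)%E by exact: g0.
  apply: (etrans (ge0_integral_independent sH HM mZ1 ind1 mf f0)).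
  by apply: eq_integral => w _; apply: (eq_integral_law (h := fun z => g (X1 w, z))).
have eqZ' A : measurable A -> P (Z' @^-1` A) = P (Z @^-1` A) by move=> mA; rewrite eqZ.
have eqZZ A : measurable A -> P (Z @^-1` A) = P (Z @^-1` A) by [].
rewrite (key G X Z sG GM mX mZ eqZZ indZ) (key G' X' Z' sG' GM' mX' mZ' eqZ' indZ').
apply: eq_integral_law => //.
- exact: measurable_wrt_fun mX.
- exact: measurable_wrt_fun mX'.
- apply: (@measurable_fun_fubini_tonelli_F _ _ R W R P (fun p => g (p.1, Z p.2))) => //.
  apply: measurableT_comp => //; apply: measurable_fun_pair => //=.
  exact: measurableT_comp.
- by move=> x; apply: integral_ge0.
Qed.

Lemma has_normal_law_affine (X : W -> R) (m v k c : R) : 0 < v -> k != 0 ->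
  has_normal_law P X m v ->
  has_normal_law P (fun w => k * X w + c) (k * m + c) (k ^+ 2 * v).
Proof.
move=> v0 k0 [mX lX]; split.
  by apply: measurable_funD => //; exact: measurable_funM.
move=> C mC.
have mC' : measurable ((fun x : R => k * x + c) @^-1` C).
  rewrite -[X in measurable X]setTI.
  have : measurable_fun [set: R] (fun x : R => k * x + c).
    by apply: measurable_funD => //; exact: measurable_funM.
  exact.
rewrite sqrtrM ?sqr_ge0// sqrtr_sqr -normal_prob_affine//; last by rewrite gt_eqF// sqrtr_gt0.
by rewrite -lX.
Qed.

End SumLaw.

Section BrownianLaw.
Context {d : measure_display} {W : measurableType d} {R : realType}.
Variables (P : probability W R) (F : R -> set (set W)) (B : R -> W -> R).
Hypotheses (hF : stochastic_basis P F) (hB : brownian_motion P F B).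

Lemma filtration_sigma t : 0 <= t -> sigma_algebra [set: W] (F t).
Proof. by case: hF => H _ _ _ /H[]. Qed.

Lemma filtration_measurable t : 0 <= t -> F t `<=` measurable.
Proof. by case: hF => H _ _ _ /H[]. Qed.

Lemma measurable_wrt_le s t (X : W -> R) : 0 <= s -> s <= t ->
  measurable_wrt (F s) X -> measurable_wrt (F t) X.
Proof. by move=> s0 st mX C mC; case: hF => _ H _ _; apply: (H s t) => //; exact: mX. Qed.

Lemma measurable_wrtD t (X Y : W -> R) : 0 <= t ->
  measurable_wrt (F t) X -> measurable_wrt (F t) Y ->
  measurable_wrt (F t) (fun w => X w + Y w).
Proof.
move=> t0 /(measurable_wrtP (filtration_sigma t0)) mX /(measurable_wrtP (filtration_sigma t0)) mY.
by apply/(measurable_wrtP (filtration_sigma t0)); exact: measurable_funD.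
Qed.

Lemma measurable_wrtM t (X Y : W -> R) : 0 <= t ->
  measurable_wrt (F t) X -> measurable_wrt (F t) Y ->
  measurable_wrt (F t) (fun w => X w * Y w).
Proof.
move=> t0 /(measurable_wrtP (filtration_sigma t0)) mX /(measurable_wrtP (filtration_sigma t0)) mY.
by apply/(measurable_wrtP (filtration_sigma t0)); exact: measurable_funM.
Qed.

Lemma measurable_wrt_cst t c : 0 <= t -> measurable_wrt (F t) ((fun=> c) : W -> R).
Proof. by move=> t0; apply/(measurable_wrtP (filtration_sigma t0)). Qed.

Lemma measurable_wrt_increment s t r : 0 <= s -> s <= t -> t <= r ->
  measurable_wrt (F r) (fun w => B t w - B s w).
Proof.
move=> s0 st tr; have t0 := le_trans s0 st; have r0 := le_trans t0 tr.
have mB u : 0 <= u -> u <= r -> measurable_wrt (F r) (B u).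
  by move=> u0 ur; apply: (measurable_wrt_le u0 ur); case: hB => H _ _ _ _; exact: H.
have -> : (fun w => B t w - B s w) = (fun w => B t w + -1 * B s w).
  by apply/funext => w; rewrite mulN1r.
apply: measurable_wrtD => //; first exact: mB.
by apply: measurable_wrtM => //; [exact: measurable_wrt_cst|apply: mB => //; exact: le_trans tr].
Qed.

Lemma brownian_independent s t : 0 <= s -> s < t ->
  independent_of P (fun w => B t w - B s w) (F s).
Proof. by case: hB => _ _ _ H _; exact: H. Qed.

Lemma brownian_law s t : 0 <= s -> s < t ->
  has_normal_law P (fun w => B t w - B s w) 0 (t - s).
Proof. by case: hB => _ _ _ _; exact. Qed.

Lemma independent_of_scale (Z : W -> R) (G : set (set W)) (c : R) :
  independent_of P Z G -> independent_of P (fun w => c * Z w) G.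
Proof.
move=> ind A C GA mC.
have mC' : measurable ((fun x : R => c * x) @^-1` C).
  rewrite -[X in measurable X]setTI.
  by have : measurable_fun [set: R] (fun x : R => c * x) by [exact: measurable_funM]; exact.
exact: (ind A _ GA mC').
Qed.

(** Variances add.  The sum [X + c * (B t - B s)] has the same law as
    [(m + B v - B 0) + (B v' - B v)], two independent terms with the same laws as
    [X] and as the scaled increment; and this telescopes to [m + B v' - B 0], whose
    law is known. *)
Lemma normal_add_increment (X : W -> R) (m v s t c : R) :
  0 <= s -> s <= t -> 0 < v -> measurable_wrt (F s) X -> has_normal_law P X m v ->
  has_normal_law P (fun w => X w + c * (B t w - B s w)) m (v + c ^+ 2 * (t - s)).
Proof.
move=> s0 st v0 mX lawX; have [mX' lX] := lawX.
have t0 := le_trans s0 st.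
have [c0|c0] := eqVneq c 0.
  rewrite c0 expr0n /= mul0r addr0.
  by have -> : (fun w => X w + 0 * (B t w - B s w)) = X by apply/funext => w; rewrite mul0r addr0.
move: st; rewrite le_eqVlt => /predU1P[<-|st].
  rewrite subrr mulr0 addr0.
  have -> : (fun w => X w + c * (B s w - B s w)) = X.
    by apply/funext => w; rewrite subrr mulr0 addr0.
  by [].
set v' := v + _.
have vv' : v < v' by rewrite ltrDl mulr_gt0 ?subr_gt0// exprn_even_gt0.
have v0' := ltW v0.
have lawZ : has_normal_law P (fun w => c * (B t w - B s w)) 0 (v' - v).
  have := @has_normal_law_affine _ _ _ P _ 0 (t - s) c 0 _ c0 (brownian_law s0 st).
  rewrite subr_gt0 => /(_ st); rewrite mulr0 addr0 /v' addrAC subrr add0r.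
  by under eq_fun do rewrite addr0.
have [mZ lZ] := lawZ.
have [mZ' lZ'] := brownian_law v0' vv'.
have lawX' : has_normal_law P (fun w => B v w - B 0 w + m) m v.
  have := @has_normal_law_affine _ _ _ P _ 0 (v - 0) 1 m _ (oner_neq0 _) (brownian_law (lexx 0) v0).
  rewrite subr0 => /(_ v0); rewrite mul1r add0r expr1n mul1r.
  by under eq_fun do rewrite mul1r.
have [_ lX'] := lawX'.
have lawS : has_normal_law P (fun w => B v' w - B 0 w + m) m v'.
  have v'0 := lt_trans v0 vv'.
  have := @has_normal_law_affine _ _ _ P _ 0 (v' - 0) 1 m _
    (oner_neq0 _) (brownian_law (lexx 0) v'0).
  rewrite subr0 => /(_ v'0); rewrite mul1r add0r expr1n mul1r.
  by under eq_fun do rewrite mul1r.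
split; first by exact: measurable_funD.
move=> C mC.
rewrite (@independent_sum_law _ _ _ P (F s) (F v) X
  (fun w => B v w - B 0 w + m) _ (fun w => B v' w - B v w))//.
- have e : (fun w => B v w - B 0 w + m + (B v' w - B v w)) =
           (fun w => B v' w - B 0 w + m) by apply/funext => w; ring.
  by rewrite e; case: lawS => _ ->.
- exact: filtration_sigma.
- exact: filtration_measurable.
- exact: filtration_sigma.
- exact: filtration_measurable.
- apply: measurable_wrtD => //; first exact: measurable_wrt_increment.
  exact: measurable_wrt_cst.
- by move=> A mA; rewrite lX// lX'.
- by move=> A mA; rewrite lZ// lZ'.
- by apply: independent_of_scale; exact: brownian_independent.
- exact: brownian_independent.
Qed.

End BrownianLaw.
(** * Integrals of deterministic step functions *)

Section StepFunctions.
Context {R : realType}.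
Implicit Types (t e : nat -> R) (n : nat) (l : seq (R * R * R)) (a b u : R).

Definition partition_of a b n t :=
  (forall i, (i <= n)%N -> a <= t i <= b) /\ (forall i, (i < n)%N -> t i <= t i.+1).

Definition partition_value n t e u : R :=
  \sum_(i < n) e i * \1_(`]t i, t i.+1]) u.

(** The intervals are disjoint: right of [t n] the first [n] terms vanish, so the
    cross terms do. *)
Lemma partition_value_sqr a b n t e u : partition_of a b n t ->
  partition_value n t e u ^+ 2 = partition_value n t (fun i => e i ^+ 2) u.
Proof.
move=> [_]; elim: n => [|n IH] H; first by rewrite /partition_value !big_ord0 expr0n.
have H' i : (i < n)%N -> t i <= t i.+1 by move=> ni; apply: H; exact: ltnW.
rewrite /partition_value !big_ord_recr /= -/(partition_value n t e u).
rewrite -/(partition_value n t (fun i => e i ^+ 2) u) -IH// indicE.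
case: (boolP (u \in _)) => [|_]; last by rewrite !mulr0 !addr0.
rewrite inE /= in_itv /= => /andP[tu _].
suff -> : partition_value n t e u = 0 by rewrite expr0n /= !add0r !mulr1.
rewrite /partition_value big1// => i _; rewrite indicE.
case: (boolP (u \in _)) => [|_]; last by rewrite mulr0.
rewrite inE /= in_itv /= => /andP[_ ut].
suff : t i.+1 <= t n by move=> tt; have := lt_le_trans tu (le_trans ut tt); rewrite ltxx.
move: (ltn_ord i); move: (nat_of_ord i) => j.
elim: {-2}n (leqnn n) => // k IHk kn; rewrite leq_eqVlt => /predU1P[->//|jk].
by rewrite (le_trans (IHk (ltnW kn) jk))// H'.
Qed.

Lemma measurable_partition_value n t e (D : set R) :
  measurable_fun D (partition_value n t e).
Proof.
apply: measurable_funTS; apply: measurable_sum => i.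
by apply: measurable_funM => //; exact: measurable_indic.
Qed.

Lemma integral_partition_value a b n t e : partition_of a b n t ->
  (forall i, 0 <= e i) ->
  (\int[lebesgue_measure]_(u in `[a, b]) (partition_value n t e u)%:E)%E =
  (\sum_(i < n) e i * (t i.+1 - t i))%:E.
Proof.
move=> [tab tt] e0.
under eq_integral do rewrite /partition_value -sumEFin.
rewrite ge0_integral_sum//; last 2 first.
- move=> i; apply/measurable_EFinP; apply: measurable_funTS.
  by apply: measurable_funM => //; exact: measurable_indic.
- by move=> i u _; rewrite lee_fin mulr_ge0.
rewrite -sumEFin; apply: eq_bigr => i _.
under eq_integral do rewrite EFinM.
rewrite ge0_integralZl//; last first.
- by rewrite lee_fin.
- by apply/measurable_EFinP; apply: measurable_funTS; exact: measurable_indic.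
rewrite integral_indic// [RHS]EFinM; congr (_ * _)%E.
rewrite (_ : `]t i, t i.+1] `&` `[a, b] = `]t i, t i.+1]%classic).
  apply: etrans (lebesgue_measure_itv _) _.
  rewrite /= lte_fin -EFinB lt_neqAle tt// andbT.
  by case: eqVneq => //= ->; rewrite subrr.
apply/seteqP; split => [u [] //|u /=]; rewrite !in_itv /= => /andP[h1 h2].
split; first by rewrite h1.
have /andP[at_ _] := tab i (ltnW (ltn_ord i)).
have /andP[_ tb] := tab i.+1 (ltn_ord i).
by rewrite (le_trans at_ (ltW h1)) (le_trans h2 tb).
Qed.

Lemma integral_partition_value_sqr a b n t e : partition_of a b n t ->
  (\int[lebesgue_measure]_(u in `[a, b]) (partition_value n t e u ^+ 2)%:E)%E =
  (\sum_(i < n) e i ^+ 2 * (t i.+1 - t i))%:E.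
Proof.
move=> H; rewrite -(integral_partition_value (e := fun i => e i ^+ 2) H); last first.
  by move=> i; exact: sqr_ge0.
by apply: eq_integral => u _; rewrite (partition_value_sqr _ _ H).
Qed.

(** A step function is a list of triples [(c, a, b)], each standing for [c] times
    the indicator of [(a, b]]; the intervals may overlap, so that addition is
    concatenation.  [step_sum] applied to a path of [B] is the integral of the step
    function, and applied to [x |-> (u <= x)] it is its value at [u]: one identity
    valid for every [f] serves both. *)
Definition step_sum l (f : R -> R) : R := \sum_(p <- l) p.1.1 * (f p.2 - f p.1.2).

Definition step_value l u : R := step_sum l (fun x => (u <= x)%R%:R).

Definition step_on a b l :=
  all (fun p : R * R * R => (a <= p.1.2) && (p.1.2 <= p.2) && (p.2 <= b)) l.

Lemma indic_itvoc a b u : a <= b ->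
  \1_(`]a, b]) u = (u <= b)%R%:R - (u <= a)%R%:R :> R.
Proof.
move=> ab; rewrite indicE; case: (boolP (u \in _)) => [|]; rewrite ?inE ?notin_setE /= in_itv /=.
  by move=> /andP[au ->]; rewrite leNgt au subr0.
move=> /negP; rewrite negb_and -leNgt -ltNge => /orP[ua|bu].
  by rewrite ua (le_trans ua ab) subrr.
by rewrite leNgt bu leNgt (le_lt_trans ab bu) subrr.
Qed.

Lemma step_sum_cat l1 l2 f : step_sum (l1 ++ l2) f = step_sum l1 f + step_sum l2 f.
Proof. by rewrite /step_sum big_cat. Qed.

(** Sorting all end points gives a common partition; the increment of [f] over each
    [(a, b]] telescopes over the cells between [a] and [b]. *)
Lemma step_sum_partition a b l : a <= b -> step_on a b l ->
  exists n t e, partition_of a b n t /\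
    forall f, step_sum l f = \sum_(i < n) e i * (f (t i.+1) - f (t i)).
Proof.
move=> ab /allP lab.
pose s := sort <=%R ([seq p.1.2 | p <- l] ++ [seq p.2 | p <- l]).
have s_sorted : sorted <=%R s by exact/sort_sorted/le_total.
have sab x : x \in s -> a <= x <= b.
  rewrite mem_sort mem_cat => /orP[] /mapP[p pl ->]; have /andP[/andP[h1 h2] h3] := lab _ pl.
    by rewrite h1 (le_trans h2 h3).
  by rewrite (le_trans h1 h2) h3.
pose t := nth a s.
pose e i : R := \sum_(p <- l) p.1.1 * ((index p.1.2 s <= i < index p.2 s)%N)%:R.
exists (size s).-1, t, e; split.
  split=> i.
    move=> ni; rewrite /t; case: (ltnP i (size s)) => his; last by rewrite nth_default// lexx.
    by apply: sab; exact: mem_nth.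
  move=> ni; have his : (i.+1 < size s)%N by move: ni; case: (size s).
  by move/(sortedP a): s_sorted; exact.
move=> f; rewrite /step_sum.
under [RHS]eq_bigr do rewrite /e mulr_suml.
rewrite exchange_big /= big_seq [RHS]big_seq; apply: eq_bigr => p pl.
under [RHS]eq_bigr do rewrite -mulrA.
rewrite -mulr_sumr; congr (_ * _).
have /andP[/andP[_ p12] _] := lab _ pl.
have p1s : p.1.2 \in s by rewrite mem_sort mem_cat (map_f (fun p => p.1.2) pl).
have p2s : p.2 \in s by rewrite mem_sort mem_cat (map_f (fun p => p.2) pl) orbT.
have i1 : (index p.1.2 s < size s)%N by rewrite index_mem.
have i2 : (index p.2 s < size s)%N by rewrite index_mem.
set j1 := index p.1.2 s; set j2 := index p.2 s.
have j12 : (j1 <= j2)%N.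
  move: p12; rewrite le_eqVlt => /predU1P[e12|p12]; first by rewrite /j1 /j2 e12.
  rewrite leqNgt; apply/negP => j21.
  have : p.2 <= p.1.2.
    rewrite -(nth_index a p1s) -(nth_index a p2s) -/j1 -/j2.
    by apply: (sorted_leq_nth le_trans lexx a s_sorted); rewrite ?inE// ltnW.
  by rewrite leNgt p12.
transitivity (\sum_(j1 <= i < j2) (f (t i.+1) - f (t i))).
  by rewrite telescope_sumr// /t !nth_index.
rewrite (@big_nat_widen _ _ _ _ _ (size s).-1); last by rewrite -ltnS (leq_trans i2)// leqSpred.
rewrite (@big_nat_widenl _ _ _ j1 0)// big_mkcond big_mkord; apply: eq_bigr => i _.
rewrite andbC /=; case: ifP => _; first by rewrite mul1r.
by rewrite mul0r.
Qed.

Lemma step_on_cat a b l1 l2 : step_on a b (l1 ++ l2) = step_on a b l1 && step_on a b l2.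
Proof. by rewrite /step_on all_cat. Qed.

Lemma partition_valueE a b n t e u : partition_of a b n t ->
  partition_value n t e u =
  \sum_(i < n) e i * ((u <= t i.+1)%R%:R - (u <= t i)%R%:R).
Proof. by move=> [_ H]; apply: eq_bigr => i _; rewrite indic_itvoc// H. Qed.

End StepFunctions.

Section StepLaw.
Context {d : measure_display} {W : measurableType d} {R : realType}.
Variables (P : probability W R) (F : R -> set (set W)) (B : R -> W -> R).
Hypotheses (hF : stochastic_basis P F) (hB : brownian_motion P F B).

Lemma partition_law (X : W -> R) (m v a b : R) n (t e : nat -> R) :
  0 <= a -> 0 < v -> measurable_wrt (F a) X -> has_normal_law P X m v ->
  partition_of a b n t ->
  has_normal_law P (fun w => X w + \sum_(i < n) e i * (B (t i.+1) w - B (t i) w))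
    m (v + \sum_(i < n) e i ^+ 2 * (t i.+1 - t i)).
Proof.
move=> a0 v0 mX lX [tab tt].
suff : let S w := X w + \sum_(i < n) e i * (B (t i.+1) w - B (t i) w) in
  [/\ has_normal_law P S m (v + \sum_(i < n) e i ^+ 2 * (t i.+1 - t i)),
      measurable_wrt (F (t n)) S & v <= v + \sum_(i < n) e i ^+ 2 * (t i.+1 - t i)].
  by case.
elim: n => [|n IH] in tab tt *.
  move=> /=; rewrite big_ord0 addr0; split => //.
    by under eq_fun do rewrite big_ord0 addr0.
  under eq_fun do rewrite big_ord0 addr0.
  have /andP[at0 _] := tab 0%N (leqnn _).
  exact: (measurable_wrt_le hF a0 at0).
have tn0 i : (i <= n.+1)%N -> 0 <= t i.
  by move=> ni; have /andP[at_ _] := tab i ni; exact: le_trans at_.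
have tab' i : (i <= n)%N -> a <= t i <= b by move=> ni; apply: tab; rewrite (leq_trans ni).
have tt' i : (i < n)%N -> t i <= t i.+1 by move=> ni; apply: tt; rewrite (leq_trans ni).
have := IH tab' tt'.
set S := (fun w => X w + _); set V := v + _ => -[lS mS vV] S'.
have eS w : S' w = S w + e n * (B (t n.+1) w - B (t n) w).
  by rewrite /S' big_ord_recr /= addrA.
have -> : S' = (fun w => S w + e n * (B (t n.+1) w - B (t n) w)) by apply/funext.
rewrite big_ord_recr /= addrA -/V.
have tnn : t n <= t n.+1 by apply: tt.
split.
- apply: (normal_add_increment hF hB) => //; first exact: tn0.
  exact: lt_le_trans vV.
- apply: (measurable_wrtD hF); first exact: tn0.
    by apply: (measurable_wrt_le hF (tn0 _ _) tnn mS).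
  apply: (measurable_wrtM hF); first exact: tn0.
    by apply: (measurable_wrt_cst hF); exact: tn0.
  by apply: (measurable_wrt_increment hF hB) => //; exact: tn0.
- by rewrite (le_trans vV)// lerDl mulr_ge0 ?sqr_ge0// subr_ge0.
Qed.

Lemma step_law (X : W -> R) (m v a b : R) l :
  0 <= a -> a <= b -> 0 < v -> measurable_wrt (F a) X -> has_normal_law P X m v ->
  step_on a b l ->
  exists V : R, (\int[lebesgue_measure]_(u in `[a, b]) (step_value l u ^+ 2)%:E = V%:E)%E /\
    has_normal_law P (fun w => X w + step_sum l (B ^~ w)) m (v + V).
Proof.
move=> a0 ab v0 mX lX /(step_sum_partition ab)[n [t [e [part eqs]]]].
exists (\sum_(i < n) e i ^+ 2 * (t i.+1 - t i)); split.
  rewrite -(integral_partition_value_sqr e part); apply: eq_integral => u _.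
  by rewrite /step_value eqs (partition_valueE _ _ part).
under eq_fun do rewrite eqs.
exact: (partition_law _ _ _ _ _ part).
Qed.

End StepLaw.
(** * Isometry for simple processes *)

Section L2.
Context {d : measure_display} {T : measurableType d} {R : realType}.
Variables (mu : {measure set T -> \bar R}) (D : set T).
Hypothesis mD : measurable D.

Lemma cvg_integral_sqrD (X Y : nat -> T -> R) :
  (forall n, measurable_fun D (X n)) -> (forall n, measurable_fun D (Y n)) ->
  (\int[mu]_(x in D) ((X n x) ^+ 2)%:E)%E @[n --> \oo] --> 0%E ->
  (\int[mu]_(x in D) ((Y n x) ^+ 2)%:E)%E @[n --> \oo] --> 0%E ->
  (\int[mu]_(x in D) ((X n x + Y n x) ^+ 2)%:E)%E @[n --> \oo] --> 0%E.
Proof.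
move=> mX mY cX cY.
have msq (Z : T -> R) : measurable_fun D Z -> measurable_fun D (fun x => (Z x ^+ 2)%:E).
  by move=> mZ; apply/measurable_EFinP; exact: measurable_funX.
pose U n := (2%:E * \int[mu]_(x in D) ((X n x) ^+ 2)%:E +
  2%:E * \int[mu]_(x in D) ((Y n x) ^+ 2)%:E)%E.
have cU : U n @[n --> \oo] --> 0%E.
  rewrite (_ : 0%E = (2%:E * 0 + 2%:E * 0)%E); last by rewrite mule0 adde0.
  by apply: cvgeD; [rewrite mule0|exact: cvgeZl|exact: cvgeZl].
apply: (@squeeze_cvge _ _ _ _ (cst 0%E) _ U) => //; last exact: cvg_cst.
apply: nearW => n; apply/andP; split.
  by apply: integral_ge0 => x _; rewrite lee_fin sqr_ge0.
rewrite /U -!ge0_integralZl//; try by [exact: msq | move=> x _; rewrite lee_fin sqr_ge0].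
rewrite -ge0_integralD//.
- apply: ge0_le_integral => //.
  + by move=> x _; rewrite lee_fin sqr_ge0.
  + by apply: msq; apply: measurable_funD.
  + by apply: emeasurable_funD; apply: emeasurable_funM => //; exact: msq.
  + move=> x _; rewrite -!EFinM -EFinD lee_fin.
    have := sqr_ge0 (X n x - Y n x); nra.
- by move=> x _; rewrite -EFinM lee_fin mulr_ge0// sqr_ge0.
- by apply: emeasurable_funM => //; exact: msq.
- by move=> x _; rewrite -EFinM lee_fin mulr_ge0// sqr_ge0.
- by apply: emeasurable_funM => //; exact: msq.
Qed.

End L2.

Section Isometry.
Context {d : measure_display} {W : measurableType d} {R : realType}.
Variables (P : probability W R) (F : R -> set (set W)) (B : R -> W -> R).
Hypotheses (hF : stochastic_basis P F) (hB : brownian_motion P F B).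
Local Notation K := (@normal_moment2 R).

Lemma normal_law_affine_square (Z : W -> R) (v x y : R) : 0 < v ->
  has_normal_law P Z 0 v ->
  (\int[P]_w ((x + y * Z w) ^+ 2)%:E = (x ^+ 2 + y ^+ 2 * (v * K))%:E)%E.
Proof.
move=> v0 [mZ lZ].
have mZ' : measurable_fun [set: W] (Z : W -> measurableTypeR R) by exact: mZ.
have mq : measurable_fun [set: measurableTypeR R]
    (fun z : measurableTypeR R => ((x + y * z) ^+ 2)%:E).
  apply/measurable_EFinP; apply: measurable_funX.
  by apply: measurable_funD => //; exact: measurable_funM.
transitivity (\int[pushforward P (Z : W -> measurableTypeR R)]_z ((x + y * z) ^+ 2)%:E)%E.
  by rewrite ge0_integral_pushforward// => z _; rewrite lee_fin sqr_ge0.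
have := @normal_affine_square R (Num.sqrt v) x y.
rewrite sqrtr_gt0 => /(_ v0); rewrite sqr_sqrtr ?(ltW v0)// => <-.
by apply: eq_measure_integral => A mA _; exact: lZ.
Qed.

Lemma simple_sum_measurable (a b : R) n t (eta : nat -> W -> R) :
  0 <= a -> partition_of a b n t ->
  (forall i, (i < n)%N -> measurable_wrt (F (t i)) (eta i)) ->
  measurable_wrt (F (t n)) (fun w => \sum_(i < n) eta i w * (B (t i.+1) w - B (t i) w)).
Proof.
move=> a0 [tab tt] meta.
elim: n => [|n IH] in tab tt meta *.
  under eq_fun do rewrite big_ord0.
  have /andP[at_ _] := tab 0%N (leqnn _).
  exact: (measurable_wrt_cst hF 0 (le_trans a0 at_)).
have tn0 i : (i <= n.+1)%N -> 0 <= t i.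
  by move=> ni; have /andP[at_ _] := tab i ni; exact: le_trans at_.
have tnn : t n <= t n.+1 by apply: tt.
under eq_fun do rewrite big_ord_recr /=.
apply: (measurable_wrtD hF); first exact: tn0.
  apply: (measurable_wrt_le hF (tn0 _ _) tnn) => //; apply: IH.
  - by move=> i ni; apply: tab; rewrite (leq_trans ni).
  - by move=> i ni; apply: tt; rewrite (leq_trans ni).
  - by move=> i ni; apply: meta; rewrite (leq_trans ni).
apply: (measurable_wrtM hF); first exact: tn0.
  by apply: (measurable_wrt_le hF (tn0 _ _) tnn) => //; apply: meta.
by apply: (measurable_wrt_increment hF hB) => //; exact: tn0.
Qed.

(** By induction on the number of cells.  Conditionally on [F (t n)] the last term is
    a known multiple of a centred normal variable, so [normal_law_affine_square]
    adds its contribution without a cross term. *)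
Lemma simple_isometry (a b : R) n t (eta : nat -> W -> R) :
  0 <= a -> partition_of a b n t ->
  (forall i, (i < n)%N -> measurable_wrt (F (t i)) (eta i)) ->
  (\int[P]_w ((\sum_(i < n) eta i w * (B (t i.+1) w - B (t i) w)) ^+ 2)%:E =
   \sum_(i < n) (\int[P]_w (eta i w ^+ 2)%:E) * (K * (t i.+1 - t i))%:E)%E.
Proof.
move=> a0 [tab tt] meta.
elim: n => [|n IH] in tab tt meta *.
  under eq_integral do rewrite big_ord0 expr0n /=.
  by rewrite big_ord0 integral0.
have tn0 i : (i <= n.+1)%N -> 0 <= t i.
  by move=> ni; have /andP[at_ _] := tab i ni; exact: le_trans at_.
have tnn : t n <= t n.+1 by apply: tt.
have tab' i : (i <= n)%N -> a <= t i <= b by move=> ni; apply: tab; rewrite (leq_trans ni).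
have tt' i : (i < n)%N -> t i <= t i.+1 by move=> ni; apply: tt; rewrite (leq_trans ni).
have meta' i : (i < n)%N -> measurable_wrt (F (t i)) (eta i).
  by move=> ni; apply: meta; rewrite (leq_trans ni).
rewrite big_ord_recr /= -(IH tab' tt' meta').
have mS := simple_sum_measurable a0 (conj tab' tt') meta'.
under eq_integral do rewrite big_ord_recr /=.
set S := (fun w => \sum_(i < n) eta i w * (B (t i.+1) w - B (t i) w)) in mS *.
rewrite -[LHS]/(\int[P]_w ((S w + eta n w * (B (t n.+1) w - B (t n) w)) ^+ 2)%:E)%E.
rewrite -[X in (X + _)%E]/(\int[P]_w (S w ^+ 2)%:E)%E.
have tn := tn0 n (leqnSn n).
have mSW : measurable_fun [set: W] S := measurable_wrt_fun (filtration_measurable hF tn) mS.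
have metaW : measurable_fun [set: W] (eta n).
  by apply: (measurable_wrt_fun (filtration_measurable hF tn)); exact: meta.
move: tnn; rewrite le_eqVlt => /predU1P[<-|tnn].
  rewrite subrr mulr0 mule0 adde0.
  by apply: eq_integral => w _; rewrite subrr mulr0 addr0.
pose f (p : g_sigma_algebraType (F (t n)) * R) := ((S p.1 + eta n p.1 * p.2) ^+ 2)%:E.
have mf : measurable_fun [set: g_sigma_algebraType (F (t n)) * R] f.
  apply/measurable_EFinP; apply: measurable_funX; apply: measurable_funD.
    apply: measurableT_comp; last exact: measurable_fst.
    exact/(measurable_wrtP (filtration_sigma hF tn)).
  apply: measurable_funM; last exact: measurable_snd.
  apply: measurableT_comp; last exact: measurable_fst.
  by apply/(measurable_wrtP (filtration_sigma hF tn)); exact: meta.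
have f0 p : (0 <= f p)%E by rewrite lee_fin sqr_ge0.
have lB := brownian_law hB tn tnn.
have [mZ _] := lB.
apply: (etrans (ge0_integral_independent (filtration_sigma hF tn)
  (filtration_measurable hF tn) mZ (brownian_independent hB tn tnn) mf f0)).
have d0 : 0 < t n.+1 - t n by rewrite subr_gt0.
under eq_integral => w _.
  rewrite /f /= (normal_law_affine_square _ _ d0 lB) EFinD (EFinM (eta n w ^+ 2)) mulrC.
  over.
have Kd0 : 0 <= K * (t n.+1 - t n) by rewrite mulr_ge0 ?normal_moment2_ge0// ltW.
rewrite ge0_integralD//.
- rewrite ge0_integralZr//; last by move=> w _; rewrite lee_fin sqr_ge0.
  by apply/measurable_EFinP; exact: measurable_funX.
- by move=> w _; rewrite lee_fin sqr_ge0.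
- by apply/measurable_EFinP; exact: measurable_funX.
- by move=> w _; rewrite -EFinM lee_fin mulr_ge0 ?sqr_ge0.
- by apply: emeasurable_funM => //; apply/measurable_EFinP; exact: measurable_funX.
Qed.

End Isometry.
(** * From simple processes to deterministic step functions *)

Section Approximation.
Context {d : measure_display} {W : measurableType d} {R : realType}.
Variables (P : probability W R).

Lemma integral_centered_sqr (X : W -> R) (k : R) :
  measurable_fun [set: W] X -> [bounded X w | w in [set: W]] ->
  (\int[P]_w (X w)%:E = 0)%E ->
  (\int[P]_w ((X w + k) ^+ 2)%:E = \int[P]_w (X w ^+ 2)%:E + (k ^+ 2)%:E)%E.
Proof.
move=> mX bX EX.
have Plty : (P setT < +oo)%E by rewrite probability_setT ltry.
have iX : P.-integrable setT (EFin \o X) by exact: measurable_bounded_integrable.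
have iX2 : P.-integrable setT (EFin \o (fun w => X w ^+ 2)).
  apply: measurable_bounded_integrable => //; first exact: measurable_funX.
  case: bX => M [Mr HM]; exists ((`|M| + 1) ^+ 2); split; first exact: num_real.
  move=> x Mx w _; rewrite /= normrX (le_trans _ (ltW Mx))// lerXn2r ?nnegrE ?addr_ge0//.
  by apply: HM => //; rewrite ltr_pwDr// ler_norm.
have ikX : P.-integrable setT (fun w => ((2 * k)%:E * (X w)%:E)%E) by exact: integrableZl.
under eq_integral => w _.
  rewrite sqrrD (_ : _ *+ 2 = 2 * k * X w); last by rewrite -mulr_natl; ring.
  rewrite EFinD EFinD (EFinM (2 * k)).
  over.
rewrite integralD//; last 2 first.
- exact: integrableD.
- exact: finite_measure_integrable_cst.
rewrite integralD// integralZl// EX mule0 adde0 integral_cst//=.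
by rewrite probability_setT mule1.
Qed.

Lemma fubini_tonelli_itv (a b : R) (g : W * R -> \bar R) :
  measurable_fun [set: W * R] g -> (forall p, 0 <= g p)%E ->
  (\int[P]_w \int[lebesgue_measure]_(u in `[a, b]) g (w, u) =
   \int[lebesgue_measure]_(u in `[a, b]) \int[P]_w g (w, u))%E.
Proof.
move=> mg g0.
pose G (p : W * R) := ((\1_(`[a, b]%classic : set R) p.2)%:E * g p)%E.
have mG : measurable_fun [set: W * R] G.
  apply: emeasurable_funM => //; apply/measurable_EFinP.
  by apply: measurableT_comp; [exact: measurable_indic|exact: measurable_snd].
have G0 p : (0 <= G p)%E by rewrite /G mule_ge0// lee_fin.
transitivity (\int[P]_w \int[lebesgue_measure]_u G (w, u))%E.
  apply: eq_integral => w _; rewrite integral_mkcond; apply: eq_integral => u _.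
  rewrite /G /= /patch indicE; case: ifPn => // _; first by rewrite mul1e.
  by rewrite mul0e.
rewrite (@fubini_tonelli _ _ _ _ _ P lebesgue_measure G mG G0).
rewrite [RHS]integral_mkcond; apply: eq_integral => u _.
rewrite /G /= /patch indicE; case: ifPn => // _.
  by apply: eq_integral => w _; rewrite mul1e.
by under eq_integral do rewrite mul0e; rewrite integral0.
Qed.

Variables (F : R -> set (set W)) (B : R -> W -> R).
Hypotheses (hF : stochastic_basis P F) (hB : brownian_motion P F B).
Local Notation K := (@normal_moment2 R).

Lemma measurable_partition_value2 n (t : nat -> R) (eta : nat -> W -> R) :
  (forall i, (i < n)%N -> measurable_fun [set: W] (eta i)) ->
  measurable_fun [set: W * R] (fun p => partition_value n t (eta ^~ p.1) p.2).
Proof.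
move=> meta; apply: measurable_sum => i; apply: measurable_funM.
  by apply: measurableT_comp; [exact: meta|exact: measurable_fst].
by apply: measurableT_comp; [exact: measurable_indic|exact: measurable_snd].
Qed.

(** The step function has the expectations [c i] of the coefficients of [H] as its
    values.  At each time [u] the bias-variance identity
    ([integral_centered_sqr]) splits the mean square distance of [H] to the
    deterministic [h] into the variance of [H u] and the squared distance of the
    step function to [h].  The second part gives the first bound; the isometry turns
    the first part into the second bound. *)
Lemma simple_to_step (a b : R) (H : simple_process) (h : R -> R) :
  0 <= a -> simple_process_on F a b H -> measurable_fun `[a, b] h ->
  let D := (\int[P]_w \int[lebesgue_measure]_(u in `[a, b])
             ((simple_value H u w - h u) ^+ 2)%:E)%E in
  exists l, [/\ step_on a b l,
    (\int[lebesgue_measure]_(u in `[a, b]) ((step_value l u - h u) ^+ 2)%:E <= D)%E &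
    (\int[P]_w ((simple_integral B H w - step_sum l (B ^~ w)) ^+ 2)%:E <= K%:E * D)%E].
Proof.
case: H => n t zeta a0 [] tab tt mz bz mh D.
rewrite /= in tab tt mz bz.
have part : partition_of a b n t by [].
have t0 i : (i < n)%N -> 0 <= t i.
  by move=> ni; have /andP[at_ _] := tab i (ltnW ni); exact: le_trans at_.
pose c i := fine (\int[P]_w (zeta i w)%:E)%E.
pose eta i w := zeta i w - c i.
have mzW i : (i < n)%N -> measurable_fun [set: W] (zeta i).
  by move=> ni; exact: (measurable_wrt_fun (filtration_measurable hF (t0 i ni)) (mz i ni)).
have meta i : (i < n)%N -> measurable_fun [set: W] (eta i).
  by move=> ni; apply: measurable_funB => //; exact: mzW.
have metaF i : (i < n)%N -> measurable_wrt (F (t i)) (eta i).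
  by move=> ni; apply: (measurable_wrtD hF (t0 i ni)) (mz i ni) (measurable_wrt_cst hF _ (t0 i ni)).
pose l := [seq (c i, t i, t i.+1) | i <- iota 0 n].
have lE f : step_sum l f = \sum_(i < n) c i * (f (t i.+1) - f (t i)).
  by rewrite /step_sum big_map -[X in iota 0 X]subn0 big_mkord.
have lonE : step_on a b l.
  apply/allP => p /mapP[i]; rewrite mem_iota add0n => /andP[_ ni] ->/=.
  rewrite tt//; have /andP[-> _] := tab i (ltnW ni).
  by have /andP[_ ->] := tab i.+1 ni.
pose h' := h \_ `[a, b].
have mh' : measurable_fun [set: R] h' by exact/(measurable_restrictT _ _).1.
have h'E u : u \in `[a, b]%classic -> h' u = h u by rewrite /h' /patch => ->.
pose E (p : W * R) := partition_value n t (eta ^~ p.1) p.2.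
have mE : measurable_fun [set: W * R] E by exact: measurable_partition_value2.
pose k u := partition_value n t c u - h' u.
have mk : measurable_fun [set: R] k.
  by apply: measurable_funB => //; exact: measurable_partition_value.
have mEu u : measurable_fun [set: W] (fun w => E (w, u)) by exact: measurableT_comp.
have Plty : (P setT < +oo)%E by rewrite probability_setT ltry.
(* a common bound makes all integrals below finite *)
have [M HM] : exists M : nat -> R, forall i, (i < n)%N -> forall w, `|eta i w| <= M i.
  suff /choice[M HM] : forall i, exists m : R, (i < n)%N -> forall w, `|eta i w| <= m by exists M.
  move=> i; have [ni|//] := boolP (i < n)%N; last by exists 0.
  have [m Hm] := bz i ni; exists (m + `|c i|) => _ w.
  by rewrite (le_trans (ler_normB _ _))// lerD2r.
have bnd_int (X : W -> R) (m : R) : measurable_fun [set: W] X ->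
    (forall w, `|X w| <= m) -> P.-integrable setT (EFin \o X).
  move=> mX HX; apply: measurable_bounded_integrable => //.
  exists m; split; first exact: num_real.
  by move=> x mx w _; rewrite /= (le_trans (HX w))// ltW.
have iEta i : (i < n)%N -> P.-integrable setT (EFin \o eta i).
  by move=> ni; apply: (bnd_int _ (M i)); [exact: meta|exact: HM].
have eta0 i : (i < n)%N -> (\int[P]_w (eta i w)%:E = 0)%E.
  move=> ni; have [m Hm] := bz i ni.
  have iz := bnd_int _ _ (mzW i ni) Hm.
  rewrite (eq_integral (fun w => ((EFin \o zeta i) \- cst (c i)%:E)%E w)); last first.
    by move=> w _; rewrite /eta EFinB.
  rewrite integralB//; last exact: finite_measure_integrable_cst.
  rewrite integral_cst//= probability_setT mule1 /c fineK ?subee//.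
  - exact: integrable_fin_num.
  - exact: integrable_fin_num.
have EE u : (\int[P]_w (E (w, u))%:E = 0)%E.
  rewrite /E /partition_value /=; under eq_integral do rewrite -sumEFin.
  rewrite integral_sum//; last first.
    by move=> i; under eq_fun do rewrite EFinM; apply: integrableZr => //; exact: iEta.
  rewrite big1// => i _; under eq_integral do rewrite EFinM.
  rewrite integralZr//; last exact: iEta.
  by rewrite eta0// mul0e.
have bE u : [bounded E (w, u) | w in [set: W]].
  exists (\sum_(i < n) M i); split; first exact: num_real.
  move=> x Mx w _; rewrite /= (le_trans _ (ltW Mx))// (le_trans (ler_norm_sum _ _ _))//.
  apply: ler_sum => i _; rewrite normrM (le_trans _ (HM i (ltn_ord i) w))//.
  by rewrite ler_piMr// indicE; case: (_ \in _); rewrite ?normr1 ?normr0.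
pose g1 (p : W * R) := (E p ^+ 2)%:E.
have mg1 : measurable_fun [set: W * R] g1.
  by apply/measurable_EFinP; exact: measurable_funX.
have g10 p : (0 <= g1 p)%E by rewrite lee_fin sqr_ge0.
have DE : (D = \int[P]_w \int[lebesgue_measure]_(u in `[a, b]) g1 (w, u) +
               \int[lebesgue_measure]_(u in `[a, b]) (k u ^+ 2)%:E)%E.
  pose g (p : W * R) := ((E p + k p.2) ^+ 2)%:E.
  have mg : measurable_fun [set: W * R] g.
    apply/measurable_EFinP; apply: measurable_funX; apply: measurable_funD => //.
    exact: measurableT_comp.
  have g0 p : (0 <= g p)%E by rewrite lee_fin sqr_ge0.
  transitivity (\int[P]_w \int[lebesgue_measure]_(u in `[a, b]) g (w, u))%E.
    apply: eq_integral => w _; apply: eq_integral => u uab.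
    rewrite /g /E /k /= h'E//; congr (_ ^+ 2)%:E.
    rewrite addrA; congr (_ - _); rewrite /simple_value /partition_value /= -big_split /=.
    by apply: eq_bigr => i _; rewrite /eta; ring.
  rewrite fubini_tonelli_itv// (fubini_tonelli_itv a b mg1 g10).
  rewrite -ge0_integralD//.
  - by apply: eq_integral => u _; rewrite /g /g1 /= integral_centered_sqr.
  - by move=> u _; exact: integral_ge0.
  - apply: measurable_funTS.
    exact: (@measurable_fun_fubini_tonelli_G _ _ W R R P g1).
  - by move=> u _; rewrite lee_fin sqr_ge0.
  - by apply: measurable_funTS; apply/measurable_EFinP; exact: measurable_funX.
have D1E : (\int[P]_w \int[lebesgue_measure]_(u in `[a, b]) g1 (w, u) =
    \sum_(i < n) (\int[P]_w (eta i w ^+ 2)%:E) * (t i.+1 - t i)%:E)%E.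
  under eq_integral => w _.
    rewrite /g1 /E /= (integral_partition_value_sqr (eta ^~ w) part) -sumEFin.
    under eq_bigr do rewrite EFinM.
    over.
  have dt i : (i < n)%N -> 0 <= t i.+1 - t i by move=> ni; rewrite subr_ge0 tt.
  have me i : (i < n)%N -> measurable_fun [set: W] (fun w => (eta i w ^+ 2)%:E).
    by move=> ni; apply/measurable_EFinP; apply: measurable_funX; exact: meta.
  rewrite ge0_integral_sum//.
  - apply: eq_bigr => i _; rewrite ge0_integralZr//; first exact: me.
      by move=> w _; rewrite lee_fin sqr_ge0.
    by rewrite lee_fin dt.
  - by move=> i; apply: emeasurable_funM => //; exact: me.
  - by move=> i w _; rewrite mule_ge0// lee_fin ?sqr_ge0// dt.
have D10 : (0 <= \int[P]_w \int[lebesgue_measure]_(u in `[a, b]) g1 (w, u))%E.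
  by apply: integral_ge0 => w _; apply: integral_ge0.
have k0 : (0 <= \int[lebesgue_measure]_(u in `[a, b]) (k u ^+ 2)%:E)%E.
  by apply: integral_ge0 => u _; rewrite lee_fin sqr_ge0.
exists l; split; first exact: lonE.
  rewrite DE (le_trans _ (leeDr _ D10))//.
  rewrite le_eqVlt; apply/orP; left; apply/eqP; apply: eq_integral => u uab.
  by rewrite /step_value lE /k (partition_valueE _ _ part) h'E.
rewrite DE (@le_trans _ _ (K%:E *
  \int[P]_w \int[lebesgue_measure]_(u in `[a, b]) g1 (w, u))%E)//; last first.
  by rewrite lee_wpmul2l ?lee_fin ?normal_moment2_ge0// leeDl.
rewrite D1E (eq_integral (fun w =>
  ((\sum_(i < n) eta i w * (B (t i.+1) w - B (t i) w)) ^+ 2)%:E)); last first.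
  move=> w _; rewrite lE /simple_integral /= -sumrB; congr (_ ^+ 2)%:E.
  by apply: eq_bigr => i _; rewrite /eta; ring.
rewrite (simple_isometry hF hB a0 part metaF) ge0_sume_distrr.
  rewrite le_eqVlt; apply/orP; left; apply/eqP; apply: eq_bigr => i _.
  by rewrite EFinM muleCA.
move=> i _; rewrite mule_ge0 ?lee_fin ?subr_ge0 ?tt//.
by apply: integral_ge0 => w _; rewrite lee_fin sqr_ge0.
Qed.

End Approximation.
(** * Wiener integrals as limits of step integrals *)

Section WienerLimit.
Context {d : measure_display} {W : measurableType d} {R : realType}.
Variables (P : probability W R) (F : R -> set (set W)) (B : R -> W -> R).
Hypotheses (hF : stochastic_basis P F) (hB : brownian_motion P F B).

(** [J] is the integral of the deterministic function [h], described by step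
    functions only; unlike [ito_integral], this is visibly stable under sums. *)
Definition wiener_limit (a b : R) (h : R -> R) (J : W -> R) : Prop :=
  [/\ measurable_fun `[a, b] h, measurable_fun [set: W] J &
    exists l : nat -> seq (R * R * R),
    [/\ forall n, step_on a b (l n),
      (\int[lebesgue_measure]_(u in `[a, b])
        ((step_value (l n) u - h u) ^+ 2)%:E)%E @[n --> \oo] --> 0%E
    & (\int[P]_w ((step_sum (l n) (B ^~ w) - J w) ^+ 2)%:E)%E @[n --> \oo] --> 0%E]].

Lemma measurable_step_value l (D : set R) : measurable_fun D (step_value l).
Proof.
apply: measurable_funTS; rewrite /step_value /step_sum; elim: l => [|p l IH].
  by under eq_fun do rewrite big_nil; exact: measurable_cst.
under eq_fun do rewrite big_cons.
apply: measurable_funD => //; apply: measurable_funM => //.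
have mi (x : R) : measurable_fun [set: R] (fun u => (u <= x)%R%:R : R).
  rewrite (_ : (fun u => _) = \1_(`]-oo, x]%classic)); first exact: measurable_indic.
  by apply/funext => u; rewrite indicE mem_setE in_itv /=.
exact: measurable_funB.
Qed.

Lemma measurable_brownian t : 0 <= t -> measurable_fun [set: W] (B t).
Proof.
move=> t0; apply: (measurable_wrt_fun (filtration_measurable hF t0)).
by case: hB => H _ _ _ _; exact: H.
Qed.

Lemma measurable_step_sum a b l : 0 <= a -> step_on a b l ->
  measurable_fun [set: W] (fun w => step_sum l (B ^~ w)).
Proof.
move=> a0; rewrite /step_sum; elim: l => [|p l IH] /=.
  by move=> _; under eq_fun do rewrite big_nil; exact: measurable_cst.
move=> /andP[/andP[/andP[ap pp] pb] lab]; under eq_fun do rewrite big_cons.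
apply: measurable_funD; last exact: IH.
apply: measurable_funM => //; apply: measurable_funB; apply: measurable_brownian.
  by rewrite (le_trans a0)// (le_trans ap).
by rewrite (le_trans a0).
Qed.

Lemma ito_integral_wiener_limit a b (h : R -> R) J : 0 <= a -> a <= b ->
  ito_integral P F B (fun s _ => h s) a b J -> wiener_limit a b h J.
Proof.
move=> a0 ab [mh _ mJ [Hn [simpH cH cJ]]].
have b0 := le_trans a0 ab.
have mh' : measurable_fun `[a, b] h.
  apply: (@measurable_comp _ _ _ _ _ _ (`[a, b]%classic `*` [set: W])
    (fun p : R * W => h p.1) _ (fun u => (u, point))) => //.
  - exact: measurableX.
  - by move=> _ [u uab <-] /=.
  - by apply: measurable_funTS; exact: measurable_fun_pair.
have mJ' : measurable_fun [set: W] J.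
  exact: (measurable_wrt_fun (filtration_measurable hF b0) mJ).
split => //.
pose D n := (\int[P]_w \int[lebesgue_measure]_(u in `[a, b])
             ((simple_value (Hn n) u w - h u) ^+ 2)%:E)%E.
have /choice[l Hl] n := simple_to_step hF hB a0 (simpH n) mh'.
have lon n : step_on a b (l n) by case: (Hl n).
exists l; split; first exact: lon.
  apply: (@squeeze_cvge _ _ _ _ (cst 0%E) _ D) => //; last exact: cvg_cst.
  apply: nearW => n; apply/andP; split; last by case: (Hl n).
  by apply: integral_ge0 => u _; rewrite lee_fin sqr_ge0.
have mI n : measurable_fun [set: W] (simple_integral B (Hn n)).
  have [tab tt mz _] := simpH n.
  have part : partition_of a b (sp_size (Hn n)) (sp_time (Hn n)) by [].
  have tn0 : 0 <= sp_time (Hn n) (sp_size (Hn n)).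
    by have /andP[at_ _] := tab _ (leqnn _); exact: le_trans at_.
  apply: (measurable_wrt_fun (filtration_measurable hF tn0)).
  exact: (simple_sum_measurable hF hB a0 part mz).
have mS n := measurable_step_sum a0 (lon n).
rewrite (_ : (fun n => _) = (fun n => \int[P]_w
    (((step_sum (l n) (B ^~ w) - simple_integral B (Hn n) w) +
      (simple_integral B (Hn n) w - J w)) ^+ 2)%:E)%E); last first.
  apply/funext => n; apply: eq_integral => w _; congr (_ ^+ 2)%:E; ring.
apply: cvg_integral_sqrD => //; try by move=> n; exact: measurable_funB.
apply: (@squeeze_cvge _ _ _ _ (cst 0%E) _ (fun n => (@normal_moment2 R)%:E * D n)%E).
- apply: nearW => n; apply/andP; split.
    by apply: integral_ge0 => u _; rewrite lee_fin sqr_ge0.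
  have [_ _] := Hl n; apply: le_trans; rewrite le_eqVlt; apply/orP; left; apply/eqP.
  by apply: eq_integral => w _; rewrite -sqrrN opprB.
- exact: cvg_cst.
- by rewrite -(mule0 (@normal_moment2 R)%:E); exact: cvgeZl.
Qed.

Lemma wiener_limitD a b (h1 h2 : R -> R) J1 J2 : 0 <= a ->
  wiener_limit a b h1 J1 -> wiener_limit a b h2 J2 ->
  wiener_limit a b (fun u => h1 u + h2 u) (fun w => J1 w + J2 w).
Proof.
move=> a0 [mh1 mJ1 [l1 [on1 h1c J1c]]] [mh2 mJ2 [l2 [on2 h2c J2c]]].
split; [exact: measurable_funD|exact: measurable_funD|].
exists (fun n => l1 n ++ l2 n); split.
- by move=> n; rewrite step_on_cat on1 on2.
- rewrite (_ : (fun n => _) = (fun n => \int[lebesgue_measure]_(u in `[a, b])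
    (((step_value (l1 n) u - h1 u) + (step_value (l2 n) u - h2 u)) ^+ 2)%:E)%E); last first.
    apply/funext => n; apply: eq_integral => u _; congr (_ ^+ 2)%:E.
    by rewrite /step_value step_sum_cat; ring.
  apply: cvg_integral_sqrD => //; move=> n; apply: measurable_funB => //;
    exact: measurable_step_value.
- rewrite (_ : (fun n => _) = (fun n => \int[P]_w
    (((step_sum (l1 n) (B ^~ w) - J1 w) +
      (step_sum (l2 n) (B ^~ w) - J2 w)) ^+ 2)%:E)%E); last first.
    apply/funext => n; apply: eq_integral => u _; congr (_ ^+ 2)%:E.
    by rewrite step_sum_cat; ring.
  apply: cvg_integral_sqrD => //; move=> n; apply: measurable_funB => //.
    exact: measurable_step_sum (on1 n).
  exact: measurable_step_sum (on2 n).
Qed.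

End WienerLimit.
(** * The law of a Wiener integral *)

Section SquareLimit.
Context {d : measure_display} {T : measurableType d} {R : realType}.
Variables (mu : {measure set T -> \bar R}) (D : set T).
Hypothesis mD : measurable D.

(** Young's inequality for the cross term of (Y + (X - Y)) ^ 2; it replaces the
   triangle inequality of the L2 norm. *)
Let young (X Y : T -> R) (e U V c : R) : 0 < e ->
  measurable_fun D X -> measurable_fun D Y ->
  (\int[mu]_(x in D) (X x ^+ 2)%:E)%E = U%:E ->
  (\int[mu]_(x in D) (Y x ^+ 2)%:E)%E = V%:E ->
  (\int[mu]_(x in D) ((X x - Y x) ^+ 2)%:E)%E = c%:E ->
  U <= (1 + e) * V + (1 + e^-1) * c.
Proof.
move=> e0 mX mY EU EV Ec.
have msq (Z : T -> R) : measurable_fun D Z -> measurable_fun D (fun x => (Z x ^+ 2)%:E).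
  by move=> mZ; apply/measurable_EFinP; exact: measurable_funX.
have mXY : measurable_fun D (fun x => X x - Y x) by exact: measurable_funB.
have e1 : 0 <= 1 + e by rewrite addr_ge0// ltW.
have e2 : 0 <= 1 + e^-1 by rewrite addr_ge0// invr_ge0 ltW.
rewrite -lee_fin EFinD !EFinM -EU -EV -Ec.
rewrite -!ge0_integralZl//; try by [exact: msq | move=> x _; rewrite lee_fin sqr_ge0].
rewrite -ge0_integralD//.
- apply: ge0_le_integral => //.
  + by move=> x _; rewrite lee_fin sqr_ge0.
  + exact: msq.
  + by apply: emeasurable_funD; apply: emeasurable_funM => //; exact: msq.
  + move=> x _; rewrite -!EFinM -EFinD lee_fin -subr_ge0.
    rewrite (_ : _ - _ = (e * Y x - (X x - Y x)) ^+ 2 / e).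
      by rewrite divr_ge0 ?sqr_ge0// ltW.
    by field; rewrite gt_eqF.
- by move=> x _; rewrite -EFinM lee_fin mulr_ge0// sqr_ge0.
- by apply: emeasurable_funM => //; exact: msq.
- by move=> x _; rewrite -EFinM lee_fin mulr_ge0// sqr_ge0.
- by apply: emeasurable_funM => //; exact: msq.
Qed.

Lemma cvg_integral_sqr (X : nat -> T -> R) (Y : T -> R) (U : nat -> R) (V : R) :
  (forall n, measurable_fun D (X n)) -> measurable_fun D Y ->
  (forall n, (\int[mu]_(x in D) (X n x ^+ 2)%:E)%E = (U n)%:E) ->
  (\int[mu]_(x in D) (Y x ^+ 2)%:E)%E = V%:E ->
  (\int[mu]_(x in D) ((X n x - Y x) ^+ 2)%:E)%E @[n --> \oo] --> 0%E ->
  U n @[n --> \oo] --> V.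
Proof.
move=> mX mY EU EV /fine_cvgP[fin cv].
have V0 : 0 <= V by rewrite -lee_fin -EV; apply: integral_ge0 => x _; rewrite lee_fin sqr_ge0.
apply/cvgrPdist_le => eps eps0.
pose e := eps / (2 * (V + 1)).
have V1 : 0 < V + 1 by rewrite ltr_wpDl.
have e0 : 0 < e by rewrite divr_gt0// mulr_gt0.
have eV : e * V <= eps / 2.
  rewrite /e invfM mulrA -mulrA ler_piMr ?divr_ge0 ?(ltW eps0)//.
  by rewrite mulrC ler_pdivrMr// mul1r lerDl.
have c0 : 0 < 1 + e^-1 by rewrite addr_gt0// invr_gt0.
have nc : \forall n \near \oo,
    `|fine (\int[mu]_(x in D) ((X n x - Y x) ^+ 2)%:E)| <= (1 + e^-1)^-1 * (eps / 2).
  apply: (cvgr0_norm_le (fine \o _) cv).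
  by apply: mulr_gt0; rewrite ?invr_gt0// divr_gt0.
near=> n.
have fn : (\int[mu]_(x in D) ((X n x - Y x) ^+ 2)%:E)%E \is a fin_num by near: n.
have cn : `|fine (\int[mu]_(x in D) ((X n x - Y x) ^+ 2)%:E)| <= (1 + e^-1)^-1 * (eps / 2).
  by near: n; exact: nc.
pose c := fine (\int[mu]_(x in D) ((X n x - Y x) ^+ 2)%:E)%E.
have Ec : (\int[mu]_(x in D) ((X n x - Y x) ^+ 2)%:E)%E = c%:E by rewrite fineK.
have cs : (1 + e^-1) * c <= eps / 2.
  rewrite -ler_pdivlMl// (le_trans (ler_norm c))//.
have cge0 : 0 <= c.
  by apply: fine_ge0; apply: integral_ge0 => x _; rewrite lee_fin sqr_ge0.
have H1 := young e0 (mX n) mY (EU n) EV Ec.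
have Ec' : (\int[mu]_(x in D) ((Y x - X n x) ^+ 2)%:E)%E = c%:E.
  by rewrite -Ec; apply: eq_integral => x _; rewrite -sqrrN opprB.
have H2 := young e0 mY (mX n) EV (EU n) Ec'.
rewrite distrC ler_norml; apply/andP; split; last lra.
have [UV|VU] := leP V (U n); first lra.
have : e * U n <= e * V by rewrite ler_wpM2l// ltW.
lra.
Unshelve. all: end_near. Qed.

End SquareLimit.

Lemma Phi_continuous {R : realType} : continuous (@Phi R).
Proof.
have H (x y : R) : `|Phi x - Phi y| <= normal_peak 1 * `|x - y|.
  wlog xy : x y / x <= y.
    move=> wl; have [|/ltW] := leP x y; first exact: wl.
    by rewrite distrC [X in _ * X]distrC; exact: wl.
  have Pxy : Phi x <= Phi y.
    by move: xy; rewrite le_eqVlt => /predU1P[->//|/Phi_increasing/ltW].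
  rewrite distrC ger0_norm ?subr_ge0// distrC ger0_norm ?subr_ge0//.
  exact: Phi_lipschitz.
move=> x; apply/cvgrPdist_le => e e0.
have p0 : 0 < normal_peak 1 :> R by rewrite normal_peak_gt0// oner_eq0.
near=> y; apply: (le_trans (H x y)); rewrite -ler_pdivlMl//.
near: y; apply: cvgr_dist_le; first exact: cvg_id.
by apply: mulr_gt0 => //; rewrite invr_gt0.
Unshelve. all: end_near. Qed.

Section LawOfLimit.
Context {d : measure_display} {W : measurableType d} {R : realType}.
Variables (P : probability W R) (F : R -> set (set W)) (B : R -> W -> R).
Hypotheses (hF : stochastic_basis P F) (hB : brownian_motion P F B).

Lemma chebyshev_sqr (Z : W -> R) (e : R) : 0 < e -> measurable_fun [set: W] Z ->
  (P [set w | (e <= `|Z w|)%R] <= (e ^+ 2)^-1%:E * \int[P]_w (Z w ^+ 2)%:E)%E.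
Proof.
move=> e0 mZ.
have mS : measurable [set w | e <= `|Z w|].
  rewrite -[X in measurable X]setTI.
  by apply: measurable_fun_le => //; exact: measurableT_comp.
have e20 : 0 < e ^+ 2 by rewrite exprn_gt0.
rewrite -(lee_pmul2l _ (_ : (0 < (e ^+ 2)%:E)%E)) ?lte_fin//.
rewrite muleA -EFinM divff ?gt_eqF// mul1e.
rewrite -(setIT [set w | _]) -integral_indic// -ge0_integralZl//; last 2 first.
- by apply/measurable_EFinP; exact: measurable_indic.
- by rewrite lee_fin ltW.
apply: ge0_le_integral => //.
- by move=> w _; rewrite mule_ge0 ?lee_fin// ltW.
- by apply: emeasurable_funM => //; apply/measurable_EFinP; exact: measurable_indic.
- by apply/measurable_EFinP; exact: measurable_funX.
- move=> w _; rewrite -EFinM lee_fin indicE.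
  case: (boolP (w \in _)) => [|_]; last by rewrite mulr0 sqr_ge0.
  by rewrite inE /= mulr1 => ez; rewrite -[X in _ <= X]real_normK ?num_real// lerXn2r ?nnegrE// ltW.
Qed.

(** Slutsky's argument: off an event of small probability (Chebyshev) the limit
    differs from its step approximation by at most [e], so the two distribution
    functions are squeezed between shifts by [e] of each other; then [n] tends to
    infinity and [e] to [0]. *)
Lemma wiener_limit_cdf (X J : W -> R) (m v a b A x : R) (h : R -> R) :
  0 <= a -> a <= b -> 0 < v -> measurable_wrt (F a) X -> has_normal_law P X m v ->
  wiener_limit P B a b h J ->
  (\int[lebesgue_measure]_(u in `[a, b]) (h u ^+ 2)%:E)%E = A%:E ->
  fine (P [set w | X w + J w <= x]) = Phi ((x - m) / Num.sqrt (v + A)).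
Proof.
move=> a0 ab v0 mX lX [mh mJ [l [on hc Jc]]] EA.
have mXW := lX.1.
have A0 : 0 <= A by rewrite -lee_fin -EA; apply: integral_ge0 => u _; rewrite lee_fin sqr_ge0.
have /choice[V HV] n := step_law hF hB a0 ab v0 mX lX (on n).
have V0 n : 0 <= V n.
  by rewrite -lee_fin -(HV n).1; apply: integral_ge0 => u _; rewrite lee_fin sqr_ge0.
have cV : V n @[n --> \oo] --> A.
  have ms n : measurable_fun `[a, b] (step_value (l n)) by exact: measurable_step_value.
  have := @cvg_integral_sqr _ (measurableTypeR R) R lebesgue_measure `[a, b]%classic
    (measurable_itv _) (fun n => step_value (l n)) h V A ms mh (fun n => (HV n).1) EA hc.
  exact.
pose I n w := step_sum (l n) (B ^~ w).
have mI n : measurable_fun [set: W] (I n) by exact: (measurable_step_sum hF hB a0 (on n)).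
have pE n y : P [set w | X w + I n w <= y] = (Phi ((y - m) / Num.sqrt (v + V n)))%:E.
  rewrite -normal_prob_itvNy ?sqrtr_gt0 ?ltr_wpDr// -(HV n).2.2//; congr (P _).
have cp y : Phi ((y - m) / Num.sqrt (v + V n)) @[n --> \oo] --> Phi ((y - m) / Num.sqrt (v + A)).
  apply: (continuous_cvg _ (@Phi_continuous R _)).
  apply: cvgM; first exact: cvg_cst.
  apply: cvgV; first by rewrite gt_eqF// sqrtr_gt0 ltr_wpDr.
  apply: (continuous_cvg _ (@sqrt_continuous R _)).
  by apply: cvgD => //; exact: cvg_cst.
move/fine_cvgP: Jc => [Jfin Jc].
have mle (Z : W -> R) y : measurable_fun [set: W] Z -> measurable [set w | Z w <= y].
  by move=> mZ; rewrite -[X in measurable X]setTI; apply: measurable_fun_le.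
have mXJ : measurable_fun [set: W] (fun w => X w + J w) by exact: measurable_funD.
have mXI n : measurable_fun [set: W] (fun w => X w + I n w) by exact: measurable_funD.
have mS n e : measurable [set w | e <= `|I n w - J w|].
  rewrite -[X in measurable X]setTI.
  by apply: measurable_fun_le => //; apply: measurableT_comp => //; exact: measurable_funB.
set q := fine _.
have qE : P [set w | X w + J w <= x] = q%:E by rewrite fineK// fin_num_measure//; exact: mle.
pose z n := fine (\int[P]_w ((I n w - J w) ^+ 2)%:E)%E.
have cz e : (e ^+ 2)^-1 * z n @[n --> \oo] --> 0.
  by rewrite -(mulr0 (e ^+ 2)^-1); apply: cvgM; [exact: cvg_cst|exact: Jc].
have cheb e : 0 < e -> \forall n \near \oo,
    (P [set w | (e <= `|I n w - J w|)%R] <= ((e ^+ 2)^-1 * z n)%:E)%E.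
  move=> e0; near=> n; rewrite EFinM /z fineK; last by near: n.
  by apply: chebyshev_sqr => //; exact: measurable_funB.
have up e : 0 < e -> q <= Phi ((x + e - m) / Num.sqrt (v + A)).
  move=> e0; rewrite -[leRHS]addr0.
  apply: (cvgr_to_ge (cvgD (cp (x + e)) (cz e))); near=> n.
  rewrite -lee_fin EFinD -qE -pE.
  apply: (@le_trans _ _ (P ([set w | X w + I n w <= x + e] `|` [set w | e <= `|I n w - J w|]))).
    apply: le_measure; rewrite ?inE; [exact: mle|by apply: measurableU => //; exact: mle|].
    move=> w /= XJ; have [|h1] := leP e `|I n w - J w|; [by right|left].
    by have := le_lt_trans (ler_norm _) h1; lra.
  apply: le_trans (measureU2 _ _ _) _ => //; first exact: mle.
  by apply: leeD => //; near: n; exact: cheb.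
have low e : 0 < e -> Phi ((x - e - m) / Num.sqrt (v + A)) <= q.
  move=> e0; rewrite -[leRHS]addr0.
  apply: (ler_cvg_to (cp (x - e)) (cvgD (cvg_cst q) (cz e))); near=> n.
  rewrite -lee_fin EFinD -qE -pE.
  apply: (@le_trans _ _ (P ([set w | X w + J w <= x] `|` [set w | e <= `|I n w - J w|]))).
    apply: le_measure; rewrite ?inE; [exact: mle|by apply: measurableU => //; exact: mle|].
    move=> w /= XJ; have [|h1] := leP e `|I n w - J w|; [by right|left].
    by move: h1; rewrite distrC => h1; have := le_lt_trans (ler_norm _) h1; lra.
  apply: le_trans (measureU2 _ _ _) _ => //; first exact: mle.
  by apply: leeD => //; near: n; exact: cheb.
have ce (s : R) : Phi ((x + s * n.+1%:R^-1 - m) / Num.sqrt (v + A)) @[n --> \oo] -->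
    Phi ((x - m) / Num.sqrt (v + A)).
  apply: (continuous_cvg _ (@Phi_continuous R _)).
  apply: cvgMl; apply: cvgB; last exact: cvg_cst.
  rewrite -[X in _ --> X]addr0; apply: cvgD; first exact: cvg_cst.
  by rewrite -(mulr0 s); apply: cvgM; [exact: cvg_cst|exact: cvg_harmonic].
apply/eqP; rewrite eq_le; apply/andP; split.
  apply: (cvgr_to_ge (ce 1)); apply: nearW => n; rewrite mul1r; apply: up.
  by rewrite invr_gt0.
apply: (cvgr_to_le (ce (-1))); apply: nearW => n; rewrite mulN1r; apply: low.
by rewrite invr_gt0.
Unshelve. all: end_near. Qed.

End LawOfLimit.
(** * Real analysis: integrals over intervals and last exit times *)

Section RealAnalysis.
Context {R : realType}.
Local Notation mu := (@lebesgue_measure R).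
Implicit Types (a b s t y : R) (f : R -> R).

Lemma bounded_integrable_itv a b f (M : R) : measurable_fun `[a, b] f ->
  (forall u, a <= u <= b -> `|f u| <= M) -> mu.-integrable `[a, b] (EFin \o f).
Proof.
move=> mf HM; apply: measurable_bounded_integrable => //.
  have := lebesgue_measure_itv `[a, b]; rewrite /= => ->.
  by case: ifP => // _; rewrite -EFinB ltry.
exists M; split; first exact: num_real.
move=> x Mx u /=; rewrite in_itv /= => uab; rewrite (le_trans _ (ltW Mx))//.
exact: HM.
Qed.

Lemma Rintegral_itvccB a s b f : a <= s <= b ->
  mu.-integrable `[a, b] (EFin \o f) ->
  \int[mu]_(u in `[a, b]) f u = \int[mu]_(u in `[a, s]) f u + \int[mu]_(u in `]s, b]) f u.
Proof.
move=> /andP[as_ sb] fi; apply/eqP; rewrite addrC -subr_eq; apply/eqP.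
by rewrite Rintegral_itvB//= bnd_simp.
Qed.

(** A vanishing integral would make [f] zero almost everywhere on an interval of
    positive length. *)
Lemma Rintegral_gt0 a b f : a < b -> mu.-integrable `[a, b] (EFin \o f) ->
  (forall u, a <= u <= b -> 0 < f u) -> 0 < \int[mu]_(u in `[a, b]) f u.
Proof.
move=> ab fi f0.
have F0 : 0 <= \int[mu]_(u in `[a, b]) f u.
  by apply: Rintegral_ge0 => u /=; rewrite in_itv /= => /f0/ltW.
rewrite lt_neqAle F0 andbT; apply/eqP => E.
have mf : measurable_fun `[a, b] (EFin \o f) by exact: measurable_int fi.
have /(ae_eq_integral_abs mu _ mf).1 : (\int[mu]_(u in `[a, b]) `|(EFin \o f) u| = 0)%E.
  have fin : (\int[mu]_(u in `[a, b]) (EFin \o f) u)%E \is a fin_num.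
    by apply: integrable_fin_num => //; exact: measurable_itv.
  transitivity (\int[mu]_(u in `[a, b]) (EFin \o f) u)%E.
    apply: eq_integral => u; rewrite inE /= in_itv /= => /f0 h.
    by rewrite ger0_norm// ltW.
  by rewrite -(fineK fin) [fine _](_ : _ = \int[mu]_(u in `[a, b]) f u)// -E.
move=> /(_ (measurable_itv _)) [N [mN N0 subN]].
have : (mu `[a, b]%classic <= mu N)%E.
  apply: le_measure; rewrite ?inE// => u /= uab; apply: subN => /=.
  move=> /(_ uab) [] fu0; move: uab; rewrite in_itv /= => /f0; by rewrite fu0 ltxx.
rewrite N0; have := lebesgue_measure_itv `[a, b]; rewrite /= lte_fin ab => ->.
by rewrite -EFinB lee_fin leNgt subr_gt0 ab.
Qed.

(** Sequences rather than filters, because dominated convergence is about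
    sequences. *)
Definition seq_continuous (a b : R) (f : R -> R) :=
  forall (u : nat -> R) (s : R), (forall n, a <= u n <= b) -> a <= s <= b ->
    u n @[n --> \oo] --> s -> f (u n) @[n --> \oo] --> f s.

Lemma cvg_invS (c : R) : c * n.+1%:R^-1 @[n --> \oo] --> 0.
Proof. by rewrite -[X in _ --> X](mulr0 c); apply: cvgM; [exact: cvg_cst|exact: cvg_harmonic]. Qed.

(** The point [s] is the supremum of [f >= y]: it is a limit of points of that set,
    and a limit from the right of points where [f < y]. *)
Lemma last_exit a b y f : a <= b -> seq_continuous a b f -> y <= f a -> f b < y ->
  exists s, [/\ a <= s < b, f s = y & forall u, s < u <= b -> f u < y].
Proof.
move=> ab fc fa fb.
pose A := [set u | a <= u <= b /\ y <= f u].
have Aa : A a by split => //; rewrite lexx.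
have Ab : ubound A b by move=> u [/andP[]].
have hA : has_sup A by split; [exists a|exists b].
pose s := sup A.
have as_ : a <= s by apply: sup_upper_bound.
have sb : s <= b by apply: ge_sup => //; exists a.
have sab : a <= s <= b by rewrite as_.
have ys : y <= f s.
  have H n : exists u, A u /\ s - n.+1%:R^-1 < u.
    have [|u Au su] := @sup_adherent _ A n.+1%:R^-1 _ hA; last by exists u.
    by rewrite invr_gt0.
  have [u Hu] := choice H.
  have cu : u n @[n --> \oo] --> s.
    apply: (@squeeze_cvgr _ _ _ _ (fun n => s + -1 * n.+1%:R^-1) (cst s)).
    - apply: nearW => n; have [Au su] := Hu n; rewrite mulN1r ltW//=.
      exact: sup_upper_bound.
    - by rewrite -[X in _ --> X]addr0; apply: cvgD; [exact: cvg_cst|exact: cvg_invS].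
    - exact: cvg_cst.
  have cf := fc u s (fun n => (Hu n).1.1) sab cu.
  by apply: (cvgr_to_ge cf); apply: nearW => n; exact: (Hu n).1.2.
have sltb : s < b by rewrite lt_neqAle sb andbT; apply/eqP => e; rewrite e leNgt fb in ys.
have after u : s < u <= b -> f u < y.
  move=> /andP[su ub]; rewrite ltNge; apply/negP => yu.
  have : u <= s by apply: sup_upper_bound => //; split=> //; rewrite (le_trans as_ (ltW su)).
  by rewrite leNgt su.
exists s; split => //; first by rewrite as_.
apply/eqP; rewrite eq_le ys andbT.
pose u n := s + (b - s) * n.+1%:R^-1.
have u1 n : s < u n <= b.
  rewrite /u ltrDl mulr_gt0 ?subr_gt0 ?invr_gt0//= -lerBrDl ler_piMr ?subr_ge0//.
  by rewrite invf_le1// ler1n.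
have cu : u n @[n --> \oo] --> s.
  by rewrite -[X in _ --> X]addr0; apply: cvgD; [exact: cvg_cst|exact: cvg_invS].
have uab n : a <= u n <= b.
  by have /andP[h1 ->] := u1 n; rewrite (le_trans as_ (ltW h1)).
by apply: (cvgr_to_le (fc u s uab sab cu)); apply: nearW => n; rewrite ltW// after.
Qed.

Lemma seq_continuous_within a b f : seq_continuous a b f -> {within `[a, b], continuous f}.
Proof.
move=> fc; apply/subspace_continuousP => s /=; rewrite in_itv /= => sab.
apply/cvgrPdist_le => e e0; apply: contrapT => H.
have G n : exists u, [/\ a <= u <= b, `|s - u| < n.+1%:R^-1 & e < `|f s - f u|].
  apply: contrapT => Hn; apply: H.
  exists n.+1%:R^-1 => /=; first by rewrite invr_gt0.
  move=> u su /=; rewrite in_itv /= => uab; rewrite leNgt; apply/negP => h.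
  by apply: Hn; exists u.
have [u Hu] := choice G.
have cu : u n @[n --> \oo] --> s.
  apply/cvgrPdist_le => d d0.
  have : \forall n \near \oo, `|0 - 1 * n.+1%:R^-1 : R| <= d.
    by apply: (cvgrPdist_le _ _).1 d d0; exact: cvg_invS.
  apply: filterS => n; rewrite sub0r normrN mul1r ger0_norm ?invr_ge0//; apply: le_trans.
  by have [_ /ltW] := Hu n.
have cf := fc u s (fun n => let: And3 h _ _ := Hu n in h) sab cu.
have := (cvgrPdist_lt _ _).1 cf e e0 => -[N _ /(_ N (leqnn N))] /=.
by have [_ _ h] := Hu N; move=> /(lt_trans h); rewrite ltxx.
Qed.

End RealAnalysis.
(** * Escape inequalities *)

Section EscapeInequalities.
Context {R : rcfType}.

(** Here [r ^+ 2] and [q ^+ 2] are the variances at two times, [c * r] is the centred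
    mean at the first one and [dm] the increment of the mean.  Since
    [q ^+ 2 - r ^+ 2 = (q - r) * (q + r)] and [q + r >= 2 * r0], a quarter of the
    variance increment dominates [|c| * (q - r)]. *)
Lemma no_upcrossing (c r0 r q dm : R) : 0 < r0 -> r0 <= r -> r <= q ->
  `|c| < r0 / 2 -> dm <= - (4^-1 * (q ^+ 2 - r ^+ 2)) -> c * r + dm <= c * q.
Proof.
move=> r00 r0r rq /ltr_normlP[c1 c2] dmle.
have : 0 <= (q - r) * (4^-1 * (q + r) + c) by apply: mulr_ge0; lra.
nra.
Qed.

Lemma no_downcrossing (c r0 r q dm : R) : 0 < r0 -> r0 <= r -> r <= q ->
  `|c| < r0 / 2 -> 4^-1 * (q ^+ 2 - r ^+ 2) <= dm -> c * q <= c * r + dm.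
Proof.
move=> r00 r0r rq /ltr_normlP[c1 c2] dmle.
have : 0 <= (q - r) * (4^-1 * (q + r) - c) by apply: mulr_ge0; lra.
nra.
Qed.

Lemma level_forces_equality (c r0 q dm : R) : 0 < r0 -> r0 <= q ->
  `|c| < r0 / 2 -> 4^-1 * (q ^+ 2 - r0 ^+ 2) <= dm -> c * q = c * r0 + dm -> q = r0.
Proof.
move=> r00 r0q /ltr_normlP[c1 c2] dmle e; apply/eqP; rewrite eq_le r0q andbT leNgt.
apply/negP => r0q'.
have : 0 < (q - r0) * (4^-1 * (q + r0) - c) by apply: mulr_gt0; lra.
nra.
Qed.

End EscapeInequalities.

(** * Continuity of distribution functions in time *)

Section ProbabilityFacts.
Context {d : measure_display} {W : measurableType d} {R : realType}.
Variables (P : probability W R).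

Lemma measurable_sublevel (X : W -> R) x : measurable_fun [set: W] X ->
  measurable [set w | X w <= x].
Proof. by move=> mX; rewrite -[X in measurable X]setTI; apply: measurable_fun_le. Qed.

Lemma ae_eq_sublevel (X X' : W -> R) (x : R) :
  measurable_fun [set: W] X -> measurable_fun [set: W] X' ->
  {ae P, forall w, X w = X' w} ->
  P [set w | X w <= x] = P [set w | X' w <= x].
Proof.
move=> mX mX' XX'.
have mS := measurable_sublevel x mX; have mS' := measurable_sublevel x mX'.
rewrite -(setIT [set w | X w <= x]) -(setIT [set w | X' w <= x]).
rewrite -!integral_indic//; apply: ae_eq_integral => //.
- by apply/measurable_EFinP; exact: measurable_indic.
- by apply/measurable_EFinP; exact: measurable_indic.
- apply: filterS XX' => w Xw _; congr EFin; rewrite !indicE.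
  by congr (nat_of_bool _)%:R; apply/idP/idP; rewrite !inE /= Xw.
Qed.

Lemma continuous_cdf_atomless (X : W -> R) (G : R -> R) x :
  measurable_fun [set: W] X -> continuous G ->
  (forall y, fine (P [set w | X w <= y]) = G y) -> P [set w | X w = x] = 0%E.
Proof.
move=> mX cG HG; apply/eqP; rewrite eq_le measure_ge0 andbT.
have finP A : measurable A -> P A \is a fin_num by move=> mA; exact: fin_num_measure.
have mE : measurable [set w | X w = x].
  rewrite (_ : [set w | _] = X @^-1` [set x])//.
  by rewrite -[X in measurable X]setTI; apply: mX => //; exact: measurable_set1.
rewrite -(fineK (finP _ mE)) lee_fin.
have H n : fine (P [set w | X w = x]) <= G x - G (x + -1 * n.+1%:R^-1).
  rewrite -!HG lerBrDr -fineD; [|exact: finP|by apply: finP; exact: measurable_sublevel].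
  have lt_ : x + -1 * n.+1%:R^-1 < x by rewrite mulN1r ltrBlDr ltrDl invr_gt0.
  rewrite -measureU//; last 2 first.
  - exact: measurable_sublevel.
  - by rewrite -subset0 => w [/= ->]; rewrite leNgt lt_.
  rewrite fine_le ?finP//.
  - by apply: measurableU => //; exact: measurable_sublevel.
  - exact: measurable_sublevel.
  apply: le_measure; rewrite ?inE.
  + by apply: measurableU => //; exact: measurable_sublevel.
  + exact: measurable_sublevel.
  + by move=> w [/= ->//|/= h]; rewrite (le_trans h)// ltW.
have cv : G x - G (x + -1 * n.+1%:R^-1) @[n --> \oo] --> 0.
  rewrite -[X in _ --> X](subrr (G x)); apply: cvgB; first exact: cvg_cst.
  apply: (continuous_cvg _ (cG x)).
  by rewrite -[X in _ --> X]addr0; apply: cvgD; [exact: cvg_cst|exact: cvg_invS].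
by apply: (cvgr_to_ge cv); apply: nearW.
Qed.

(** Off the null set [Y = x] the indicators of [X n <= x] are eventually equal to that
    of [Y <= x]. *)
Lemma cvg_cdf_at (X : nat -> W -> R) (Y : W -> R) (x : R) :
  (forall n, measurable_fun [set: W] (X n)) -> measurable_fun [set: W] Y ->
  (forall w, X n w @[n --> \oo] --> Y w) -> P [set w | Y w = x] = 0%E ->
  fine (P [set w | X n w <= x]) @[n --> \oo] --> fine (P [set w | Y w <= x]).
Proof.
move=> mX mY cX Y0.
have mE : measurable [set w | Y w = x].
  rewrite (_ : [set w | _] = Y @^-1` [set x])//.
  by rewrite -[X in measurable X]setTI; apply: mY => //; exact: measurable_set1.
pose f n w : \bar R := (\1_[set w | X n w <= x] w)%:E.
pose f0 w : \bar R := (\1_[set w | Y w <= x] w)%:E.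
have mf n : measurable_fun [set: W] (f n).
  by apply/measurable_EFinP; apply: measurable_indic; exact: measurable_sublevel.
have mf0 : measurable_fun [set: W] f0.
  by apply/measurable_EFinP; apply: measurable_indic; exact: measurable_sublevel.
have i1 : P.-integrable setT (cst 1%E) by exact: finite_measure_integrable_cst.
have aec : {ae P, forall w, setT w -> f n w @[n --> \oo] --> f0 w}.
  exists [set w | Y w = x]; split => // w /= H; apply: contrapT => Yx; apply: H => _.
  apply: cvg_near_cst; rewrite /f /f0.
  have [Yltx|xltY|//] := ltgtP (Y w) x.
  - apply: filterS (cvgr_lt _ (cX w) _ Yltx) => n Xn; congr EFin.
    by rewrite !indicE !mem_set//= ltW.
  - apply: filterS (cvgr_gt _ (cX w) _ xltY) => n Xn; congr EFin.
    by rewrite !indicE !memNset//= leNgt ?Xn ?xltY.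
have ae1 : {ae P, forall w n, setT w -> (`|f n w| <= cst 1 w)%E}.
  by apply: aeW => w n _; rewrite /f /= lee_fin ger0_norm// indicE.
have [_ _] := dominated_convergence measurableT mf mf0 aec i1 ae1.
have eI (Z : W -> R) : measurable_fun [set: W] Z ->
    (\int[P]_w (\1_[set w | Z w <= x] w)%:E = P [set w | (Z w <= x)%R])%E.
  by move=> mZ; rewrite integral_indic ?setIT//; exact: measurable_sublevel.
rewrite (eI _ mY) => cv.
apply: fine_cvg; rewrite fineK; last by apply: fin_num_measure; exact: measurable_sublevel.
by under eq_fun do rewrite -(eI _ (mX _)).
Qed.

End ProbabilityFacts.
(** * The law of a solution *)

Section RealIntegrable.
Context {d : measure_display} {T : measurableType d} {R : realType}.
Variables (mu : {measure set T -> \bar R}) (D : set T).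
Hypothesis mD : measurable D.

Lemma integrable_EFinD (f g : T -> R) : mu.-integrable D (EFin \o f) ->
  mu.-integrable D (EFin \o g) -> mu.-integrable D (EFin \o (fun u => f u + g u)).
Proof. by move=> If Ig; exact: (integrableD mD If Ig). Qed.

Lemma integrable_EFinZl k (f : T -> R) : mu.-integrable D (EFin \o f) ->
  mu.-integrable D (EFin \o (fun u => k * f u)).
Proof. by move=> If; exact: (integrableZl mD k If). Qed.

End RealIntegrable.

Section Coefficients.
Context {R : realType}.
Local Notation mu := (@lebesgue_measure R).
Implicit Types f : R -> R.

Lemma coefficient_measurable f (a b : R) : 0 <= a -> {within `[0, +oo[, continuous f} ->
  measurable_fun `[a, b] f.
Proof.
move=> a0 cf; apply: measurable_realfun.subspace_continuous_measurable_fun => //.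
apply: continuous_subspaceW cf => u /=; rewrite !in_itv /= andbT => /andP[au _].
exact: le_trans au.
Qed.

Lemma coefficient_bounded f : [bounded f t | t in `[0, +oo[%classic] ->
  exists M : R, forall u, 0 <= u -> `|f u| <= M.
Proof.
move=> [M [_ HM]]; exists (M + 1) => u u0.
by apply: (HM (M + 1)) => /=; rewrite ?ltrDl// in_itv /= u0.
Qed.

End Coefficients.

Section Solution.
Context {d : measure_display} {W : measurableType d} {R : realType}.
Variables (P : probability W R) (F : R -> set (set W)) (B : R -> W -> R).
Hypotheses (hF : stochastic_basis P F) (hB : brownian_motion P F B).
Variables (t0 y : R) (alpha1 alpha2 beta1 beta2 : R -> R).
Hypotheses (t0_ge0 : 0 <= t0)
  (ca1 : {within `[0, +oo[, continuous alpha1})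
  (ca2 : {within `[0, +oo[, continuous alpha2})
  (cb1 : {within `[0, +oo[, continuous beta1})
  (cb2 : {within `[0, +oo[, continuous beta2})
  (ba1 : [bounded alpha1 t | t in `[0, +oo[%classic])
  (ba2 : [bounded alpha2 t | t in `[0, +oo[%classic])
  (bb1 : [bounded beta1 t | t in `[0, +oo[%classic])
  (bb2 : [bounded beta2 t | t in `[0, +oo[%classic]).
Variables (xi : W -> R) (mu0 m v : R).
Hypotheses (mxi : measurable_wrt (F t0) xi) (v_gt0 : 0 < v)
  (lxi : has_normal_law P xi m v).
Variables (t1 : R) (Y : R -> W -> R).
Hypothesis sol : solution P F B t0 y alpha1 alpha2 beta1 beta2 xi mu0 t1%:E Y.

Local Notation mu := (@lebesgue_measure R).
Local Notation phi := (cdf_at_mu0 P mu0 Y).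
Local Notation dn := (below P y mu0 Y).
Local Notation up := (above P y mu0 Y).

(** The two stochastic integrals of the equation are merged into one, with
    integrand [volatility].  The mean keeps the two drift integrals apart: they can
    be merged only once the switching indicators are known to be measurable, and
    that is deduced from the law of [Y t] ([measurable_dn]). *)
Definition volatility u := dn u * alpha1 u + up u * alpha2 u.
Definition drift u := dn u * beta1 u + up u * beta2 u.
Definition variance_at t := v + \int[mu]_(u in `[t0, t]) (volatility u ^+ 2).
Definition mean_at t := m + (\int[mu]_(u in `[t0, t]) (dn u * beta1 u) +
  \int[mu]_(u in `[t0, t]) (up u * beta2 u)).

Lemma first_regime u : phi u < y -> drift u = beta1 u /\ volatility u = alpha1 u.
Proof.
rewrite /drift /volatility /below /above => phiy; rewrite leNgt phiy /=.
by rewrite !mul1r !mul0r !addr0.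
Qed.

Lemma second_regime u : y <= phi u -> drift u = beta2 u /\ volatility u = alpha2 u.
Proof.
rewrite /drift /volatility /below /above => yphi; rewrite ltNge yphi /=.
by rewrite !mul1r !mul0r !add0r.
Qed.

Lemma dn_bound u : `|dn u| <= 1.
Proof. by rewrite /below normr_nat; case: (_ < _)%R. Qed.

Lemma up_bound u : `|up u| <= 1.
Proof. by rewrite /above normr_nat; case: (y <= _)%R. Qed.

Lemma switched_bounded (f g : R -> R) :
  [bounded f t | t in `[0, +oo[%classic] -> [bounded g t | t in `[0, +oo[%classic] ->
  exists M : R, forall u, 0 <= u -> `|dn u * f u + up u * g u| <= M.
Proof.
move=> /coefficient_bounded[M1 H1] /coefficient_bounded[M2 H2].
exists (M1 + M2) => u u0; rewrite (le_trans (ler_normD _ _))// !normrM lerD//.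
  by rewrite -[leRHS]mul1r ler_pM// ?dn_bound ?H1.
by rewrite -[leRHS]mul1r ler_pM// ?up_bound ?H2.
Qed.

Lemma volatility_sqr_integrable t : measurable_fun `[t0, t] volatility ->
  mu.-integrable `[t0, t] (EFin \o (fun u => volatility u ^+ 2)).
Proof.
move=> mvol; have [M HM] := switched_bounded ba1 ba2.
apply: (bounded_integrable_itv (M := M ^+ 2)); first exact: measurable_funX.
move=> u /andP[tu _]; have u0 := le_trans t0_ge0 tu.
by rewrite normrX lerXn2r ?nnegrE ?HM// (le_trans (normr_ge0 _) (HM u u0)).
Qed.

Lemma variance_at_ge t : v <= variance_at t.
Proof. by rewrite lerDl; apply: Rintegral_ge0 => u _; exact: sqr_ge0. Qed.

Lemma solution_measurable t : t0 <= t < t1 -> measurable_fun [set: W] (Y t).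
Proof.
move=> /andP[tt tT]; have t_ge0 := le_trans t0_ge0 tt.
apply: (measurable_wrt_fun (filtration_measurable hF t_ge0)).
by case: sol => H _ _ _; apply: H; split => //; rewrite lte_fin.
Qed.

Lemma solution_volatility_measurable t : t0 <= t < t1 -> measurable_fun `[t0, t] volatility.
Proof.
move=> /andP[tt tT]; have t_ge0 := le_trans t0_ge0 tt.
case: sol => _ _ H _; have [|J1 [J2 [I1 I2 _]]] := H t; first by split => //; rewrite lte_fin.
have [w1 _ _] := ito_integral_wiener_limit hF hB t0_ge0 tt I1.
have [w2 _ _] := ito_integral_wiener_limit hF hB t0_ge0 tt I2.
exact: measurable_funD.
Qed.

(** The two Ito integrals add up to the Wiener integral of [volatility]; the two drift
    integrals are constants and shift the level [x]. *)
Lemma solution_cdf t x : t0 <= t < t1 ->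
  fine (P [set w | Y t w <= x]) = Phi ((x - mean_at t) / Num.sqrt (variance_at t)).
Proof.
move=> tI; have /andP[tt tT] := tI; have t_ge0 := le_trans t0_ge0 tt.
case: sol => _ _ H _; have [|J1 [J2 [I1 I2 EY]]] := H t; first by split => //; rewrite lte_fin.
have w1 := ito_integral_wiener_limit hF hB t0_ge0 tt I1.
have w2 := ito_integral_wiener_limit hF hB t0_ge0 tt I2.
have [_ mJ1 _] := w1; have [_ mJ2 _] := w2.
set m1 := \int[mu]_(u in `[t0, t]) (dn u * beta1 u) in EY.
set m2 := \int[mu]_(u in `[t0, t]) (up u * beta2 u) in EY.
have mxi' := lxi.1.
rewrite (@ae_eq_sublevel _ _ _ P (Y t) (fun w => xi w + (J1 w + m1) + (J2 w + m2))); first last.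
- exact: EY.
- by do 2 (apply: measurable_funD; last exact: measurable_funD).
- exact: solution_measurable.
rewrite (_ : [set w | _] = [set w | xi w + (J1 w + J2 w) <= x - (m1 + m2)]); last first.
  by apply/seteqP; split => w /=; lra.
have fin : (\int[mu]_(u in `[t0, t]) (volatility u ^+ 2)%:E)%E \is a fin_num.
  apply: integrable_fin_num; first exact: measurable_itv.
  by apply: volatility_sqr_integrable; exact: solution_volatility_measurable.
rewrite (wiener_limit_cdf hF hB _ t0_ge0 tt v_gt0 mxi lxi
  (wiener_limitD hF hB t0_ge0 w1 w2) (esym (fineK fin))).
have -> : x - (m1 + m2) - m = x - mean_at t by rewrite /mean_at -/m1 -/m2; ring.
by [].
Qed.

Lemma solution_atomless t x : t0 <= t < t1 -> P [set w | Y t w = x] = 0%E.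
Proof.
move=> tI; apply: (@continuous_cdf_atomless _ _ _ P (Y t)
  (fun x => Phi ((x - mean_at t) / Num.sqrt (variance_at t)))).
- exact: solution_measurable.
- move=> z; apply: (continuous_cvg _ (@Phi_continuous R _)).
  by apply: cvgMl; apply: cvgB; [exact: cvg_id|exact: cvg_cst].
- by move=> z; exact: solution_cdf.
Qed.

Lemma phi_seq_continuous t : t < t1 -> seq_continuous t0 t phi.
Proof.
move=> tT u s ut st us.
have T_ r : t0 <= r <= t -> t0 <= r < t1 by move=> /andP[-> rt]; exact: le_lt_trans rt _.
apply: cvg_cdf_at.
- by move=> n; apply: solution_measurable; exact/T_/ut.
- exact/solution_measurable/T_.
- move=> w; case: sol => _ cY _ _.
  have /subspace_continuousP/(_ s) := cY w.
  have I_ r : t0 <= r <= t -> time_interval t0 t1%:E r.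
    by move=> /T_/andP[r0 r1]; split => //; rewrite lte_fin.
  move=> /(_ (I_ s st)) cw A /cw [e e0 HA].
  have us' : \forall n \near \oo, `|s - u n| < e by apply: (cvgrPdist_lt _ _).1 us _ e0.
  suff : \forall n \near \oo, A (Y (u n) w) by [].
  by apply: filterS us' => n h; apply: HA => //=; exact/I_/ut.
- exact/solution_atomless/T_.
Qed.

Lemma measurable_dn t : t < t1 -> measurable_fun `[t0, t] dn.
Proof.
move=> tT.
have mphi : measurable_fun `[t0, t] phi.
  apply: measurable_realfun.subspace_continuous_measurable_fun => //.
  by apply: seq_continuous_within; exact: phi_seq_continuous.
rewrite (_ : dn = (fun b : bool => b%:R : R) \o (fun u => (phi u < y)%R))//.
apply: measurableT_comp => //.
exact: measurable_fun_ltr.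
Qed.

Lemma upE u : up u = 1 - dn u.
Proof. by rewrite /below /above leNgt; case: (_ < _)%R; rewrite ?subrr ?subr0. Qed.

Lemma measurable_up t : t < t1 -> measurable_fun `[t0, t] up.
Proof.
move=> tT; rewrite (_ : up = (fun u => 1 - dn u)); last exact/funext/upE.
by apply: measurable_funB => //; exact: measurable_dn.
Qed.

Lemma switched_integrable (k f : R -> R) t : (forall u, `|k u| <= 1) ->
  measurable_fun `[t0, t] k -> {within `[0, +oo[, continuous f} ->
  [bounded f t | t in `[0, +oo[%classic] ->
  mu.-integrable `[t0, t] (EFin \o (fun u => k u * f u)).
Proof.
move=> k1 mk cf /coefficient_bounded[M HM].
apply: (bounded_integrable_itv (M := M)).
  by apply: measurable_funM => //; exact: coefficient_measurable.
move=> u /andP[tu _]; have u0 := le_trans t0_ge0 tu.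
by rewrite normrM -[leRHS]mul1r ler_pM// ?k1 ?HM.
Qed.

Lemma mean_increment s t : t0 <= s <= t -> t < t1 ->
  mean_at t - mean_at s = \int[mu]_(u in `]s, t]) drift u.
Proof.
move=> st tT.
have i1 := switched_integrable dn_bound (measurable_dn tT) cb1 bb1.
have i2 := switched_integrable up_bound (measurable_up tT) cb2 bb2.
have sub : `]s, t] `<=` `[t0, t].
  move=> u /=; rewrite !in_itv /= => /andP[su ->]; rewrite andbT.
  by have /andP[h _] := st; rewrite (le_trans h)// ltW.
rewrite /mean_at (Rintegral_itvccB st i1) (Rintegral_itvccB st i2) /drift.
rewrite RintegralD//; last 2 first.
- exact: integrableS i1.
- exact: integrableS i2.
ring.
Qed.

Lemma variance_increment s t : t0 <= s <= t -> t < t1 ->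
  variance_at t - variance_at s = \int[mu]_(u in `]s, t]) (volatility u ^+ 2).
Proof.
move=> st tT.
have tI : t0 <= t < t1 by rewrite tT andbT; case/andP: st; exact: le_trans.
have i1 := volatility_sqr_integrable (solution_volatility_measurable tI).
rewrite /variance_at (Rintegral_itvccB st i1); ring.
Qed.

Lemma variance_at_nondecreasing s t : t0 <= s <= t -> t < t1 ->
  variance_at s <= variance_at t.
Proof.
move=> st tT; rewrite -subr_ge0 variance_increment//.
by apply: Rintegral_ge0 => u _; exact: sqr_ge0.
Qed.

Lemma drift_integrable t : t < t1 -> mu.-integrable `[t0, t] (EFin \o drift).
Proof.
move=> tT.
have i1 := switched_integrable dn_bound (measurable_dn tT) cb1 bb1.
have i2 := switched_integrable up_bound (measurable_up tT) cb2 bb2.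
by apply: integrable_EFinD.
Qed.

Lemma mean_atE t : t < t1 -> mean_at t = m + \int[mu]_(u in `[t0, t]) drift u.
Proof.
move=> tT; rewrite RintegralD//.
- exact: switched_integrable dn_bound (measurable_dn tT) cb1 bb1.
- exact: switched_integrable up_bound (measurable_up tT) cb2 bb2.
Qed.

Lemma mean_at_start : mean_at t0 = m.
Proof. by rewrite /mean_at set_itv1 !Rintegral_set1 !addr0. Qed.

Lemma variance_at_start : variance_at t0 = v.
Proof. by rewrite /variance_at set_itv1 Rintegral_set1 addr0. Qed.

Let subset_itv s t : t0 <= s <= t -> `]s, t] `<=` `[t0, t].
Proof.
move=> /andP[h _] u /=; rewrite !in_itv /= => /andP[su ->]; rewrite andbT.
by rewrite (le_trans h)// ltW.
Qed.

Let increment_integrable s t : t0 <= s <= t -> t < t1 ->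
  mu.-integrable `]s, t] (EFin \o drift) /\
  mu.-integrable `]s, t] (EFin \o (fun u => volatility u ^+ 2)).
Proof.
move=> st tT; have tI : t0 <= t < t1 by rewrite tT andbT; case/andP: st; exact: le_trans.
split; first by apply: integrableS (drift_integrable tT) => //; exact: subset_itv.
have i2 := volatility_sqr_integrable (solution_volatility_measurable tI).
by apply: integrableS i2 => //; exact: subset_itv.
Qed.

Lemma mean_increment_le k s t : t0 <= s <= t -> t < t1 ->
  (forall u, s < u <= t -> drift u <= k * volatility u ^+ 2) ->
  mean_at t - mean_at s <= k * (variance_at t - variance_at s).
Proof.
move=> st tT H; have [i1 i2] := increment_integrable st tT.
rewrite mean_increment// variance_increment// -RintegralZl//.
apply: le_Rintegral => //; exact: integrable_EFinZl.
Qed.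

Lemma mean_increment_ge k s t : t0 <= s <= t -> t < t1 ->
  (forall u, s < u <= t -> k * volatility u ^+ 2 <= drift u) ->
  k * (variance_at t - variance_at s) <= mean_at t - mean_at s.
Proof.
move=> st tT H; have [i1 i2] := increment_integrable st tT.
rewrite mean_increment// variance_increment// -RintegralZl//.
apply: le_Rintegral => //; exact: integrable_EFinZl.
Qed.

Lemma increment_combination_gt0 j k t : t0 < t < t1 ->
  (forall u, t0 <= u <= t -> 0 < j * drift u + k * volatility u ^+ 2) ->
  0 < j * (mean_at t - m) + k * (variance_at t - v).
Proof.
move=> /andP[tt tT] H.
have tI : t0 <= t < t1 by rewrite ltW.
have i1 := drift_integrable tT.
have i2 := volatility_sqr_integrable (solution_volatility_measurable tI).
rewrite mean_atE// /variance_at (addrC m) addrK (addrC v) addrK.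
rewrite -!RintegralZl// -RintegralD//.
- apply: Rintegral_gt0 => //.
  by apply: integrable_EFinD => //; exact: integrable_EFinZl.
- exact: integrable_EFinZl.
- exact: integrable_EFinZl.
Qed.

End Solution.

(** * Non-existence *)

Lemma Phi_lt {R : realType} (x y : R) : Phi x < Phi y -> x < y.
Proof.
by apply: contraTT; rewrite -!leNgt le_eqVlt => /predU1P[->//|/Phi_increasing/ltW].
Qed.

Theorem proposition3 (R : realType) (d : measure_display) (W : measurableType d)
  (P : probability W R) (F : R -> set (set W)) (B : R -> W -> R)
  (hF : stochastic_basis P F) (hB : brownian_motion P F B)
  (t0 y : R) (ht0 : 0 <= t0) (hy : 0 < y < 1)
  (alpha1 alpha2 beta1 beta2 : R -> R)
  (ha1_ge0 : forall t, 0 <= t -> 0 <= alpha1 t)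
  (ha2_ge0 : forall t, 0 <= t -> 0 <= alpha2 t)
  (ha1_cont : {within `[0, +oo[, continuous alpha1})
  (ha2_cont : {within `[0, +oo[, continuous alpha2})
  (hb1_cont : {within `[0, +oo[, continuous beta1})
  (hb2_cont : {within `[0, +oo[, continuous beta2})
  (ha1_bnd : [bounded alpha1 t | t in `[0, +oo[%classic])
  (ha2_bnd : [bounded alpha2 t | t in `[0, +oo[%classic])
  (hb1_bnd : [bounded beta1 t | t in `[0, +oo[%classic])
  (hb2_bnd : [bounded beta2 t | t in `[0, +oo[%classic])
  (xi : W -> R) (hxi : measurable_wrt (F t0) xi)
  (mu0 mut0 var0 vart0 : R)
  (hvar0 : 0 < var0) (hvart0 : 0 <= vart0)
  (hmut0 : `|mut0| <= 2^-1 * vart0)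
  (hxi_law : has_normal_law P xi (mu0 + mut0) (var0 + vart0))
  (hxi_y : P [set w | xi w <= mu0] = y%:E)
  (delta : R) (hdelta : 0 < delta)
  (h1 : forall t, t0 <= t < t0 + delta ->
     - (2^-1 * alpha1 t ^+ 2) <= beta1 t <= - (4^-1 * alpha1 t ^+ 2))
  (h2 : forall t, t0 <= t < t0 + delta ->
     4^-1 * alpha2 t ^+ 2 <= beta2 t <= 2^-1 * alpha2 t ^+ 2)
  (h1_strict :
     (forall t, t0 <= t < t0 + delta -> - (2^-1 * alpha1 t ^+ 2) < beta1 t) \/
     (forall t, t0 <= t < t0 + delta -> beta1 t < - (4^-1 * alpha1 t ^+ 2)))
  (h2_strict :
     (forall t, t0 <= t < t0 + delta -> 4^-1 * alpha2 t ^+ 2 < beta2 t) \/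
     (forall t, t0 <= t < t0 + delta -> beta2 t < 2^-1 * alpha2 t ^+ 2)) :
  ~ exists eps : R, 0 < eps < delta /\
      exists Y : R -> W -> R,
        solution P F B t0 y alpha1 alpha2 beta1 beta2 xi mu0 (t0 + eps)%:E Y.
Proof.
move=> [eps [/andP[eps_gt0 eps_lt] [Y sol]]].
pose v0 := var0 + vart0; pose m0 := mu0 + mut0.
have v0_gt0 : 0 < v0 by rewrite ltr_pwDl.
pose t1 := t0 + eps; have t01 : t0 < t1 by rewrite ltrDl.
pose phi := cdf_at_mu0 P mu0 Y.
pose M := mean_at P t0 y beta1 beta2 mu0 m0 Y.
pose V := variance_at P t0 y alpha1 alpha2 mu0 v0 Y.
pose sig t := Num.sqrt (V t).
pose r0 := Num.sqrt v0; pose c := mut0 / r0.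
have r0_gt0 : 0 < r0 by rewrite sqrtr_gt0.
have V_ge t : v0 <= V t by exact: variance_at_ge.
have V_gt0 t : 0 < V t by exact: lt_le_trans (V_ge t).
have sig_ge t : r0 <= sig t by rewrite ler_wsqrtr.
have sig_gt0 t : 0 < sig t by exact: lt_le_trans (sig_ge t).
have sigE t : sig t ^+ 2 = V t by rewrite sqr_sqrtr// ltW.
have r0E : r0 ^+ 2 = v0 by rewrite sqr_sqrtr// ltW.
have cr0 : c * r0 = mut0 by rewrite divfK// gt_eqF.
have c_small : `|c| < r0 / 2.
  rewrite /c normrM normfV (gtr0_norm r0_gt0) ltr_pdivrMr// mulrAC -expr2 r0E.
  by move: hmut0; rewrite /v0; lra.
have phiE t : t0 <= t < t1 -> phi t = Phi (- ((M t - mu0) / sig t)).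
  by move=> tI; rewrite -mulNr opprB;
    exact: (solution_cdf hF hB ht0 ha1_bnd ha2_bnd hxi v0_gt0 hxi_law sol).
have yE : y = Phi (- c).
  have [_ /(_ _ (measurable_itv `]-oo, mu0])) E] := hxi_law.
  have : y%:E = normal_prob m0 r0 `]-oo, mu0]%classic.
    by rewrite -E -hxi_y; congr (P _); apply/seteqP; split => w /=; rewrite in_itv.
  rewrite normal_prob_itvNy// => -[->]; congr Phi.
  by rewrite /m0 /c -mulNr; congr (_ / _); ring.
have M_start : M t0 = m0 by exact: mean_at_start.
have V_start : V t0 = v0 by exact: variance_at_start.
have phi_start : phi t0 = y.
  have start : t0 <= t0 < t1 by rewrite lexx.
  have sig_start : sig t0 = r0 by rewrite /sig V_start.
  have m0E : m0 - mu0 = mut0 by rewrite /m0 addrAC subrr add0r.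
  by rewrite (phiE _ start) sig_start M_start m0E -/c -yE.
have phi_lt t : t0 <= t < t1 -> phi t < y -> c * sig t < M t - mu0.
  move=> tI; rewrite phiE// yE => /Phi_lt; rewrite ltrN2 ltr_pdivlMr//.
have phi_gt t : t0 <= t < t1 -> y < phi t -> M t - mu0 < c * sig t.
  move=> tI; rewrite phiE// yE => /Phi_lt; rewrite ltrN2 ltr_pdivrMr//.
have phi_eq t : t0 <= t < t1 -> phi t = y -> M t - mu0 = c * sig t.
  move=> tI; rewrite phiE// yE => /Phi_inj/oppr_inj => <-.
  by rewrite divfK// gt_eqF.
have in_delta s t u : t0 <= s -> t < t1 -> s < u <= t -> t0 <= u < t0 + delta.
  move=> t0s tT /andP[su ut]; rewrite (le_trans t0s (ltW su)) /=.
  by rewrite (le_lt_trans ut)// (lt_trans tT)// /t1 ltrD2l.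
have V_mono s t : t0 <= s <= t -> t < t1 -> V s <= V t.
  exact: (variance_at_nondecreasing hF hB ht0 ha1_bnd ha2_bnd _ sol).
have M_le := mean_increment_le hF hB ht0 hb1_cont hb2_cont ha1_bnd ha2_bnd
  hb1_bnd hb2_bnd hxi v0_gt0 hxi_law sol.
have M_ge := mean_increment_ge hF hB ht0 hb1_cont hb2_cont ha1_bnd ha2_bnd
  hb1_bnd hb2_bnd hxi v0_gt0 hxi_law sol.
(* the first regime cannot be entered: it would push [phi] back up *)
have phi_ge t : t0 <= t < t1 -> y <= phi t.
  move=> /andP[tt tT]; rewrite leNgt; apply/negP => phit.
  have cont := phi_seq_continuous hF hB ht0 ha1_bnd ha2_bnd hxi v0_gt0 hxi_law sol tT.
  have [|s [/andP[ts st] phis after]] := last_exit tt cont _ phit; first by rewrite -/phi phi_start.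
  have sI : t0 <= s < t1 by rewrite ts (lt_trans st).
  have stI : t0 <= s <= t by rewrite ts ltW.
  have Minc : M t - M s <= - 4^-1 * (V t - V s).
    apply: (M_le _ _ _ stI tT).
    move=> u us; have := h1 u (in_delta s t u ts tT us).
    have [-> ->] := first_regime alpha1 alpha2 beta1 beta2 (after u us).
    by rewrite mulNr => /andP[].
  have := phi_lt t _ phit; rewrite tt tT => /(_ isT).
  have := phi_eq s sI phis.
  have := @no_upcrossing R c r0 (sig s) (sig t) (M t - M s) r0_gt0 (sig_ge s) _ c_small.
  rewrite !sigE ler_wsqrtr ?V_mono// => /(_ isT); lra.
(* nor can [phi] rise above [y], where the second regime pushes it down *)
have phi_le t : t0 <= t < t1 -> phi t <= y.
  move=> /andP[tt tT]; rewrite leNgt; apply/negP => phit.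
  have cont := phi_seq_continuous hF hB ht0 ha1_bnd ha2_bnd hxi v0_gt0 hxi_law sol tT.
  have contN : seq_continuous t0 t (fun u => - phi u).
    by move=> u s hu hs us; apply: cvgN; exact: cont.
  have [||s [/andP[ts st] phis after]] := @last_exit R t0 t (- y) (fun u => - phi u) tt contN.
  - by rewrite phi_start.
  - by rewrite ltrN2.
  have sI : t0 <= s < t1 by rewrite ts (lt_trans st).
  have stI : t0 <= s <= t by rewrite ts ltW.
  have Minc : 4^-1 * (V t - V s) <= M t - M s.
    apply: (M_ge _ _ _ stI tT).
    move=> u us; have := h2 u (in_delta s t u ts tT us).
    have yu : y <= phi u by have := after u us; rewrite ltrN2 => /ltW.
    have [-> ->] := second_regime alpha1 alpha2 beta1 beta2 yu.
    by move=> /andP[].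
  have := phi_gt t _ phit; rewrite tt tT => /(_ isT).
  have := phi_eq s sI (oppr_inj phis).
  have := @no_downcrossing R c r0 (sig s) (sig t) (M t - M s) r0_gt0 (sig_ge s) _ c_small.
  rewrite !sigE ler_wsqrtr ?V_mono// => /(_ isT); lra.
(* from here on [phi] is constantly [y]; any time of the open interval would do *)
pose t := t0 + eps / 2.
have tI' : t0 < t < t1 by rewrite /t /t1; apply/andP; split; lra.
have tI : t0 <= t < t1 by have /andP[/ltW -> ->] := tI'.
have /andP[t0t tT] := tI.
have reg2 u : t0 <= u <= t -> drift P y beta1 beta2 mu0 Y u = beta2 u /\
    volatility P y alpha1 alpha2 mu0 Y u = alpha2 u /\ t0 <= u < t0 + delta.
  move=> /andP[tu ut]; have uI : t0 <= u < t1 by rewrite tu (le_lt_trans ut).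
  have [-> ->] := second_regime alpha1 alpha2 beta1 beta2 (phi_ge u uI).
  do 2 split => //; rewrite tu /=.
  by have /andP[_ h] := uI; rewrite (lt_trans h)// /t1 ltrD2l.
have Minc : 4^-1 * (V t - V t0) <= M t - M t0.
  have stI : t0 <= t0 <= t by rewrite lexx.
  apply: (M_ge _ _ _ stI tT).
  move=> u /andP[tu ut]; have [|-> [-> ud]] := reg2 u; first by rewrite (ltW tu).
  by have /andP[] := h2 u ud.
have Mt : c * sig t = c * r0 + (M t - M t0).
  rewrite -phi_eq//; last by apply/eqP; rewrite eq_le phi_le// phi_ge.
  by rewrite cr0 M_start /m0; ring.
rewrite V_start -sigE -r0E in Minc.
have sigt := level_forces_equality r0_gt0 (sig_ge t) c_small Minc Mt.
have Vt : V t - v0 = 0 by rewrite -sigE sigt r0E subrr.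
have Mt0 : M t - m0 = 0 by move: Mt; rewrite sigt M_start; lra.
(* a combination of drift and squared volatility that is positive up to time [t]
   contradicts [Mt0] and [Vt] *)
have pos j k : (forall u, t0 <= u < t0 + delta -> 0 < j * beta2 u + k * alpha2 u ^+ 2) -> False.
  move=> H.
  suff : 0 < j * (M t - m0) + k * (V t - v0) by rewrite Vt Mt0 !mulr0 addr0 ltxx.
  apply: (@increment_combination_gt0 _ _ _ P F B hF hB t0 y alpha1 alpha2 beta1 beta2 ht0
    hb1_cont hb2_cont ha1_bnd ha2_bnd hb1_bnd hb2_bnd xi mu0 m0 v0 hxi v0_gt0
    hxi_law t1 Y sol j k t tI') => u /reg2[-> [-> ud]].
  exact: H.
case: h2_strict => H.
- by apply: (pos 1 (- 4^-1)) => u /H; lra.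
- by apply: (pos (-1) 2^-1) => u /H; lra.
Qed.
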